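(* Let $f:X\to X$ be an acyclic countable-to-one Borel function on a standard probability space $(X,\mu)$ such that $E_f$ is measure-class-preserving, with associated Radon--Nikodym cocycle $\rho$. The following are equivalent: (1) For almost every $x\in X$, the back $f$-orbit $f^{-\mathbb N}(x)$ is $\rho$-finite. (2) There exists a strictly positive Borel function $Q:X\to(0,\infty)$ with $\sum_{n\ge0}Q(f^n(x))<\infty$ for almost every $x\in X$. (3) After discarding a null set there is a forward $f$-recurrent Borel $E_f$-complete section $Y\subseteq X$ for which the next return map $f_Y:Y\to Y$ is one-ended. (4) After discarding a null set there is a forward $f$-invariant Borel $E_f$-complete section $Z\subseteq X$ on which the restriction $f:Z\to Z$ is one-ended. (5) After discarding a null set there is a forward $f$-invariant Borel $E_f$-complete section $Z\subseteq X$ on which the restriction $f:Z\to Z$ is one-ended and moreover finite-to-one.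
   Context: $f$ is acyclic if $f^n(x)\ne x$ for all $n\ge1$, $x\in X$. For an acyclic function $g$ on a set, $T_g$ is the (acyclic) graph $\{(x,y):g(x)=y\text{ or }g(y)=x\}$, and $E_g$ is its connectedness equivalence relation. A geodesic ray is an injective infinite path; ends are classes of rays modulo having a common tail. $g$ is one-ended if every component of $T_g$ has exactly one end. The back $f$-orbit of $x$ is $f^{-\mathbb N}(x)=\bigcup_{n\ge0}f^{-n}(x)$. An $E$-complete section is a set meeting every $E$-class. $Y$ is forward $f$-invariant if $f(Y)\subseteq Y$, and forward $f$-recurrent if for each $y\in Y$ there is $n\ge1$ with $f^n(y)\in Y$; in that case $f_Y(y):=f^n(y)$ for the least such $n$. ''After discarding a null set'' means: for the restriction to the complement of some $E_f$-invariant Borel $\mu$-null set. A countable Borel equivalence relation $E$ is measure-class-preserving (mcp) on $(X,\mu)$ if the $E$-saturation of every null set is null. Its Radon--Nikodym cocycle is the (unique up to null sets) Borel $\rho:E\to(0,\infty)$ with $\rho(z,y)\rho(y,x)=\rho(z,x)$ and, writing $\rho^x(y):=\rho(y,x)$, $\int_X\sum_{y\in[x]_E}h(x,y)\,d\mu(x)=\int_X\sum_{y\in[x]_E}h(y,x)\rho^x(y)\,d\mu(x)$ for all Borel $h:E\to[0,\infty]$. A set $D\subseteq[x]_E$ is $\rho$-finite if $\sum_{y\in D}\rho^x(y)<\infty$ (independent of $x$ in the class). *)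

(* Defs.v *)
From HB Require Import structures.
From Stdlib Require Import Relation_Operators.
From mathcomp Require Import all_boot all_order all_algebra.
From mathcomp Require Import all_classical all_reals all_analysis.
From mathcomp Require Import measurable_realfun.

Set Implicit Arguments.
Unset Strict Implicit.
Unset Printing Implicit Defensive.

Import Order.TTheory GRing.Theory Num.Theory.

Local Open Scope classical_set_scope.
Local Open Scope ring_scope.

(* The sigma-algebra of X is the Borel sigma-algebra of some Polish topology;
   the topology is carried by a separate type P in bijection with X. *)
Definition standard_borel (R : realType) (d : measure_display)
    (X : measurableType d) : Prop :=
  exists (P : completePseudoMetricType R) (phi : X -> P),
    [/\ hausdorff_space P,
        exists2 S : set P, countable S & dense S,
        bijective phi &
        forall A : set X, measurable A <-> <<s @open P >> (phi @` A)].

Section Dynamics.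
Context {X : Type}.
Implicit Types (f g : X -> X) (Y Z : set X) (E : X -> X -> Prop).

Definition acyclic f : Prop :=
  forall (n : nat) (x : X), (0 < n)%N -> iter n f x <> x.

Definition countable_to_one f : Prop :=
  forall y : X, countable (f @^-1` [set y]).

Definition finite_to_one_on Z f : Prop :=
  forall z : X, Z z -> finite_set (Z `&` f @^-1` [set z]).

Definition back_orbit f (x : X) : set X :=
  [set y | exists n : nat, iter n f y = x].

(* A function g : Y -> Y is represented by a set Y and a function on the
   ambient type, whose values outside Y are irrelevant below. *)

Definition tgraph Y g (x y : X) : Prop :=
  [/\ Y x, Y y & g x = y \/ g y = x].

Definition connectedness Y g : X -> X -> Prop :=
  clos_refl_trans X (tgraph Y g).

Definition orbit_rel f : X -> X -> Prop := connectedness setT f.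

Definition geodesic_rays Y g (C : set X) : set (nat -> X) :=
  [set r | [/\ injective r,
               forall n : nat, tgraph Y g (r n) (r n.+1) &
               forall n : nat, C (r n)]].

Definition common_tail (r s : nat -> X) : Prop :=
  exists m n : nat, forall k : nat, r (m + k)%N = s (n + k)%N.

Definition ends Y g (C : set X) : set (set (nat -> X)) :=
  [set geodesic_rays Y g C `&` [set s | common_tail r s]
  | r in geodesic_rays Y g C].

Definition one_ended Y g : Prop :=
  forall x : X, Y x ->
    exists e : set (nat -> X), ends Y g [set y | connectedness Y g x y] = [set e].

Definition invariant_set E (N : set X) : Prop :=
  forall x y : X, E x y -> N x -> N y.

Definition saturation E (A : set X) : set X :=
  [set y | exists2 x, A x & E x y].

Definition complete_section (X' : set X) E Y : Prop :=
  Y `<=` X' /\ forall x : X, X' x -> exists2 y, Y y & E x y.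

Definition forward_invariant f Y : Prop := f @` Y `<=` Y.

Definition forward_recurrent f Y : Prop :=
  forall y : X, Y y -> exists2 n : nat, (0 < n)%N & Y (iter n f y).

Definition first_return_time f Y (y : X) : set nat :=
  [set n | [/\ (0 < n)%N, Y (iter n f y) &
               forall m : nat, (0 < m)%N -> Y (iter m f y) -> (n <= m)%N]].

(* The least return time; y itself is a junk value when y never returns to Y. *)
Definition next_return f Y (y : X) : X :=
  iter (xget 0%N (first_return_time f Y y)) f y.

End Dynamics.

Section MeasuredEquivalenceRelations.
Context {R : realType} {d : measure_display} {X : measurableType d}.
Implicit Types (mu : probability X R) (f : X -> X) (E : X -> X -> Prop)
  (rho : X * X -> R).

Definition measure_class_preserving mu E : Prop :=
  forall A : set X, mu.-negligible A -> mu.-negligible (saturation E A).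

Definition radon_nikodym_cocycle mu E rho : Prop :=
  [/\ measurable_fun [set z : X * X | E z.1 z.2] rho,
      forall x y : X, E x y -> 0 < rho (x, y),
      forall x y z : X, E x y -> E y z ->
        rho (z, y) * rho (y, x) = rho (z, x) &
      forall h : X * X -> \bar R,
        measurable_fun [set z : X * X | E z.1 z.2] h ->
        (forall x y : X, E x y -> 0 <= h (x, y))%E ->
        (\int[mu]_x (\esum_(y in [set y | E x y]) h (x, y)) =
         \int[mu]_x (\esum_(y in [set y | E x y])
                       (h (y, x) * (rho (y, x))%:E)))%E].

(* For D contained in the class of x; by the cocycle identity this does not
   depend on the base point x chosen in that class. *)
Definition rho_finite rho (x : X) (D : set X) : Prop :=
  (\esum_(y in D) (rho (y, x))%:E < +oo)%E.

(* P X' holds for the complement X' of some E-invariant Borel null set. *)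
Definition after_discarding_null mu E (P : set X -> Prop) : Prop :=
  exists N : set X,
    [/\ measurable N, mu N = 0%E, invariant_set E N & P (~` N)].

End MeasuredEquivalenceRelations.

(* Main.v *)
Require Import Defs.
From HB Require Import structures.
From Stdlib Require Import Relation_Operators.
From mathcomp Require Import all_boot all_order all_algebra.
From mathcomp Require Import all_classical all_reals all_analysis.
From mathcomp Require Import measurable_realfun.
From mathcomp Require Import zify.
Import Order.TTheory GRing.Theory Num.Theory.
Local Open Scope classical_set_scope.
Local Open Scope ring_scope.

Set Implicit Arguments.
Unset Strict Implicit.
Unset Printing Implicit Defensive.

(** Let R(x) be the sum of the weights rho^x(y) over the back f-orbit of x.
    Everything rests on mass transport along f: for h >= 0,

      int (sum_n h(x, f^n x)) dmu(x)
        = int (sum_(y in the back orbit of x) h(y, x) rho^x(y)) dmu(x).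

    If R is finite almost everywhere, transport with h(x, y) = exp(- R(y))
    shows that Q = exp(- R) is summable along almost every forward orbit
    ([back_finite_summable]). Conversely, a summable Q yields a recurrent set Y
    made of points where Q is not too small compared with the sum of Q over the
    rest of the orbit, arranged so that Q is bounded below on every backward
    chain of Y; the sums of Q being bounded, such a chain is finite, and a map
    is one-ended exactly when it has no infinite backward chain
    ([summable_return_one_ended], [one_endedP]). Given such a Y, the points of
    Y with infinite R would have minimal elements for the order of ancestry;
    these form an antichain, and transport shows that an antichain carrying
    infinite back mass is null ([return_one_ended_back_finite]). This makes the
    first three conditions equivalent.

    When R is finite, discard from each back orbit the points of small weight.
    If the thresholds are chosen so that at each x the weights discarded add up
    to at most e, transport shows that the points discarded at some forward
    iterate have measure at most e ([sparse_sections]). What remains has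
    finitely many points in each back orbit, and so has its forward saturation;
    letting e tend to 0 gives a forward invariant set on which f is finite-to-one
    and one-ended ([back_finite_invariant_section]). Such a set is in particular
    a recurrent section whose return map, f itself, is one-ended, and the cycle
    closes.

    Sums over back orbits and forward saturations involve images of Borel sets
    under iterates of f. They are only shown to be measurable after discarding
    a null set: by inner regularity a Borel set is, up to a null set, a countable
    union of compact sets on which f^n is continuous, and the image of the null
    set is null because E_f preserves the measure class ([image_mod_null],
    [image_iter_measurable]). A sum over back orbits is then the supremum of
    finite sums, over the cells of finer and finer partitions, of suprema whose
    superlevel sets are unions of such images ([measurable_fiber_sum]). *)

(** * Paths, ends and return maps *)

Section Orbits.
Context {X : Type}.
Implicit Types (f g : X -> X) (Y Z : set X).

Lemma iter_stable Y g n x :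
  (forall z, Y z -> Y (g z)) -> Y x -> Y (iter n g x).
Proof. by move=> gY Yx; elim: n => //= n; exact: gY. Qed.

Lemma iter_inj Y g x : (forall z, Y z -> Y (g z)) ->
  (forall n z, Y z -> (0 < n)%N -> iter n g z <> z) ->
  Y x -> injective (fun n => iter n g x).
Proof.
move=> gY ga Yx m n.
wlog mn : m n / (m <= n)%N.
  move=> H e; case/orP: (leq_total m n) => mn; first exact: H.
  by apply/esym/H.
move=> /= e; apply/eqP; rewrite eqn_leq mn /= leqNgt; apply/negP => lt_mn.
apply: (ga (n - m)%N (iter m g x)); [exact: iter_stable|by rewrite subn_gt0|].
by rewrite -iterD subnK.
Qed.

Lemma acyclic_iter_inj f x : acyclic f -> injective (fun n => iter n f x).
Proof.
by move=> fa; apply: (@iter_inj setT f x) => // n z _; exact: fa.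
Qed.

Lemma connectednessP Y g x y : (forall z, Y z -> Y (g z)) -> Y x ->
  connectedness Y g x y <->
  Y y /\ exists m n, iter m g x = iter n g y.
Proof.
move=> gY Yx; split.
  move=> c; elim: c Yx => {x y}.
  - move=> x y [Yx Yy e] _; split=> //.
    by case: e => <-; [exists 1%N, 0%N|exists 0%N, 1%N].
  - by move=> x Yx; split=> //; exists 0%N, 0%N.
  - move=> x y z _ IH1 _ IH2 Yx.
    have [Yy [m [n e1]]] := IH1 Yx.
    have [Yz [p [q e2]]] := IH2 Yy.
    split=> //; exists (p + m)%N, (n + q)%N.
    by rewrite !iterD e1 -e2 -!iterD addnC.
have fw n z : Y z ->
    connectedness Y g z (iter n g z) /\ connectedness Y g (iter n g z) z.
  move=> Yz; elim: n => [|n [IH1 IH2]]; first by split; apply: rt_refl.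
  have Yn := iter_stable n gY Yz.
  split.
    by apply: rt_trans IH1 _; apply: rt_step; split=> //;
      [exact: gY|left].
  by apply: rt_trans _ IH2; apply: rt_step; split=> //;
    [exact: gY|right].
move=> [Yy [m [n e]]]; apply: rt_trans (fw m x Yx).1 _.
by rewrite e; exact: (fw n y Yy).2.
Qed.

Lemma orbit_relP f x y :
  orbit_rel f x y <-> exists m n, iter m f x = iter n f y.
Proof.
rewrite /orbit_rel connectednessP//.
by split=> [[]//|].
Qed.

Lemma orbit_rel_refl f x : orbit_rel f x x.
Proof. by apply/orbit_relP; exists 0%N, 0%N. Qed.

Lemma orbit_rel_sym f x y : orbit_rel f x y -> orbit_rel f y x.
Proof.
by move=> /orbit_relP[m [n e]]; apply/orbit_relP; exists n, m.
Qed.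

Lemma orbit_rel_iter f n x : orbit_rel f x (iter n f x).
Proof. by apply/orbit_relP; exists n, 0%N. Qed.

Lemma orbit_rel_back f x y : back_orbit f x y -> orbit_rel f x y.
Proof. by move=> [n e]; apply/orbit_relP; exists 0%N, n. Qed.

Lemma back_orbit_trans f x y z :
  back_orbit f x y -> back_orbit f y z -> back_orbit f x z.
Proof. by move=> [m <-] [n <-]; exists (m + n)%N; rewrite iterD. Qed.

Lemma dependent_choice_nat (P : X -> Prop) (S : X -> X -> Prop) x0 :
  P x0 -> (forall x, P x -> exists2 y, P y & S x y) ->
  exists r : nat -> X,
    [/\ r 0%N = x0, forall n, P (r n) & forall n, S (r n) (r n.+1)].
Proof.
move=> Px0 PS.
have /choice[s sP] : forall u : {x | P x}, exists v : {x | P x},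
    S (sval u) (sval v).
  by move=> [x Px]; have [y Py Sxy] := PS x Px; exists (exist _ y Py).
exists (fun n => sval (iter n s (exist _ x0 Px0))); split=> //.
by move=> n; exact: svalP.
Qed.

Definition backward_ray Y g (r : nat -> X) : Prop :=
  (forall n, Y (r n)) /\ forall n, g (r n.+1) = r n.

Lemma iter_backward_ray {Y g r} n k : backward_ray Y g r ->
  iter n g (r (n + k)%N) = r k.
Proof.
by move=> [_ rS]; elim: n k => [//|n IH] k; rewrite addSn iterSr rS IH.
Qed.

Lemma backward_ray_inj Y g r : backward_ray Y g r ->
  (forall n x, Y x -> (0 < n)%N -> iter n g x <> x) -> injective r.
Proof.
move=> rr ga m n.
wlog mn : m n / (m <= n)%N.
  move=> H e; case/orP: (leq_total m n) => mn; first exact: H.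
  by apply/esym/H.
move=> e; apply/eqP; rewrite eqn_leq mn /= leqNgt; apply/negP => lt_mn.
apply: (ga (n - m)%N (r n)); [exact: rr.1|by rewrite subn_gt0|].
by have := iter_backward_ray (n - m) m rr; rewrite subnK// => ->.
Qed.

(** Injectivity forbids a forward step after a backward one, so a ray with a
    backward step would end with an infinite backward path. *)
Lemma rays_step_forward Y g :
  (forall z, Y z -> Y (g z)) ->
  (forall n z, Y z -> (0 < n)%N -> iter n g z <> z) ->
  ~ (exists r, backward_ray Y g r) ->
  forall C r, geodesic_rays Y g C r -> forall n, g (r n) = r n.+1.
Proof.
move=> gY ga nb C r [rinj rt _] n.
apply: contrapT => ne; apply: nb; exists (fun k => r (n + k)%N); split.
  by move=> k; have [] := rt (n + k)%N.
elim=> [|k IH].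
  by rewrite addn0 addn1; have [_ _ []] := rt n.
rewrite !addnS; have [_ _ [e|//]] := rt (n + k).+1.
move: IH; rewrite addnS e => /rinj; lia.
Qed.

(** Along a ray each edge is traversed either in the direction of g or against
    it, and once a ray has gone against g it must keep doing so: turning back
    would repeat a vertex. So without infinite backward paths every ray is a
    forward orbit, and two forward orbits of one component merge; conversely
    the forward orbit of a point and a backward path issued from it are two
    different ends. *)
Lemma one_endedP Y g :
  (forall z, Y z -> Y (g z)) ->
  (forall n x, Y x -> (0 < n)%N -> iter n g x <> x) ->
  one_ended Y g <-> ~ exists r, backward_ray Y g r.
Proof.
move=> gY ga.
have Yit n x : Y x -> Y (iter n g x) by exact: iter_stable.
have fw_ray x : Y x ->
    geodesic_rays Y g [set y | connectedness Y g x y] (fun n => iter n g x).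
  move=> Yx; split; first exact: (iter_inj gY ga Yx).
    by move=> n; split; [exact: Yit|exact: (Yit n.+1)|left].
  move=> n; apply/connectednessP => //; split; first exact: Yit.
  by exists n, 0%N.
split.
  move=> oe [r rr].
  have Y0 := rr.1 0%N; have [e ends_e] := oe _ Y0.
  set C := [set y | connectedness Y g (r 0%N) y] in ends_e.
  have Cr : geodesic_rays Y g C r.
    split; first exact: (backward_ray_inj rr).
      by move=> n; split; [exact: rr.1|exact: rr.1|right; exact: rr.2].
    move=> n; apply/connectednessP => //; split; first exact: rr.1.
    by exists 0%N, n; rewrite /= -{2}(addn0 n) (iter_backward_ray _ _ rr).
  have Ce s : geodesic_rays Y g C s ->
      geodesic_rays Y g C `&` [set s' | common_tail s s'] = e.
    move=> Cs; suff : [set e] (geodesic_rays Y g C `&`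
      [set s' | common_tail s s']) by [].
    by rewrite -ends_e; exists s.
  have : e r.
    rewrite -(Ce _ Cr); split=> //; by exists 0%N, 0%N.
  rewrite -(Ce _ (fw_ray _ Y0)) => -[_ [m [n mn]]].
  have e0 := mn 0%N; have e1 := mn 1%N.
  move: e1; rewrite !addnS !addn0 in e0 * => e1.
  apply: (ga 2 (iter m g (r 0%N))); [exact: Yit|by []|].
  by rewrite /= -[g (iter m g _)]/(iter m.+1 g (r 0%N)) e1 rr.2 -e0.
move=> nb x Yx.
set C := [set y | connectedness Y g x y].
have rayE r : geodesic_rays Y g C r -> forall n, r n = iter n g (r 0%N).
  move=> Cr; elim=> [//|n /= <-].
  by rewrite (rays_step_forward gY ga nb Cr).
exists (geodesic_rays Y g C).
have endE r : geodesic_rays Y g C r ->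
    geodesic_rays Y g C `&` [set s | common_tail r s] = geodesic_rays Y g C.
  move=> Cr; apply/seteqP; split=> [s []//|s Cs]; split=> //.
  have [_ _ /(_ 0%N) /connectednessP c0] := Cr.
  have [_ _ /(_ 0%N) /connectednessP d0] := Cs.
  have [Yr [m [n e1]]] := c0 gY Yx.
  have [Ys [p [q e2]]] := d0 gY Yx.
  exists (n + p)%N, (q + m)%N => k; rewrite (rayE _ Cr) (rayE _ Cs).
  have -> : (n + p + k = (k + p) + n)%N by lia.
  have -> : (q + m + k = (k + m) + q)%N by lia.
  rewrite iterD -e1 -iterD (iterD (k + m)) -e2 -iterD; congr (iter _ _ _); lia.
apply/seteqP; split.
  by move=> _ [r Cr <-]; rewrite endE.
move=> _ ->; exists (fun n => iter n g x); first exact: fw_ray.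
by rewrite endE//; exact: fw_ray.
Qed.

Lemma next_returnP f Y y : forward_recurrent f Y -> Y y ->
  exists n, [/\ (0 < n)%N, next_return f Y y = iter n f y,
    Y (iter n f y) & forall m, (0 < m < n)%N -> ~ Y (iter m f y)].
Proof.
move=> rec Yy; rewrite /next_return; case: xgetP => [n _ [n0 Yn nmin]|none].
  exists n; split; [exact: n0|by []|exact: Yn|move=> m /andP[m0 mn] Ym].
  by have := nmin m m0 Ym; rewrite leqNgt mn.
have [n n0 Yn] := rec y Yy.
have exn : exists k, (0 < k)%N && `[< Y (iter k f y) >].
  by exists n; rewrite n0; apply/asboolP.
case: (ex_minnP exn) => k /andP[k0 /asboolP Yk] kmin; exfalso.
apply: (none k); split=> // m m0 Ym; apply: kmin.
by rewrite m0; apply/asboolP.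
Qed.

Lemma next_return_stable f Y y : forward_recurrent f Y -> Y y ->
  Y (next_return f Y y).
Proof. by move=> rec Yy; have [n [_ ->]] := next_returnP rec Yy. Qed.

Lemma iter_next_return f Y y n : forward_recurrent f Y -> Y y ->
  exists m, (n <= m)%N /\ iter n (next_return f Y) y = iter m f y.
Proof.
move=> rec Yy; elim: n => [|n [m [nm e]]]; first by exists 0%N.
have Yn : Y (iter n (next_return f Y) y).
  by apply: iter_stable Yy => z; exact: next_return_stable.
have [k [k0 ek _ _]] := next_returnP rec Yn.
by exists (k + m)%N; rewrite /= ek e -iterD; split=> //; lia.
Qed.

Lemma next_return_acyclic f Y : acyclic f -> forward_recurrent f Y ->
  forall n y, Y y -> (0 < n)%N -> iter n (next_return f Y) y <> y.
Proof.
move=> fa rec n y Yy n0; have [m [nm ->]] := iter_next_return n rec Yy.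
by apply: fa; lia.
Qed.

Lemma one_ended_returnP f Y : acyclic f -> forward_recurrent f Y ->
  one_ended Y (next_return f Y) <->
  ~ exists r, backward_ray Y (next_return f Y) r.
Proof.
move=> fa rec; apply: one_endedP; first by move=> z; exact: next_return_stable.
exact: next_return_acyclic.
Qed.

Lemma forward_invariant_recurrent f Z :
  forward_invariant f Z -> forward_recurrent f Z.
Proof. by move=> fZ z Zz; exists 1%N => //; apply: fZ; exists z. Qed.

(** On a forward invariant set the next return map is f itself. *)
Lemma one_ended_return_invariant f Z : acyclic f -> forward_invariant f Z ->
  one_ended Z f -> one_ended Z (next_return f Z).
Proof.
move=> fa fZ; have fZ' z : Z z -> Z (f z) by move=> Zz; apply: fZ; exists z.
have rec := forward_invariant_recurrent fZ.
move=> /(one_endedP fZ') nb; apply/one_ended_returnP => // -[r [Zr rS]].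
apply: nb => [n x _|]; first exact: fa.
exists r; split=> // n; have [k [k0 ek _ kmin]] := next_returnP rec (Zr n.+1).
rewrite -(rS n) ek; case: k k0 kmin {ek} => [//|[//|k] _ kmin].
by exfalso; apply: (kmin 1%N) => //=; apply: fZ'.
Qed.

(** The witness is the last point of Y met strictly before b on the path
    from a to b. *)
Lemma return_preimage f Y a b n : forward_recurrent f Y -> Y a -> Y b ->
  (0 < n)%N -> iter n f a = b ->
  exists2 c, next_return f Y c = b & exists2 j, Y c & c = iter j f a.
Proof.
move=> rec; elim/ltn_ind: n a => n IH a Ya Yb n0 ab.
have [k [k0 ek Yk kmin]] := next_returnP rec Ya.
have [kn|nk|kn] := ltngtP k n.
- have [|||c cb [j Yc ce]] := IH (n - k)%N _ (iter k f a) Yk Yb; try lia.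
    by rewrite -iterD subnK// ltnW.
  by exists c => //; exists (j + k)%N => //; rewrite iterD.
- by exfalso; apply: (kmin n); [rewrite n0|rewrite ab].
- by exists a; [rewrite ek kn|exists 0%N].
Qed.

End Orbits.

(** * Inner regularity and images of Borel sets *)

Section FiniteMeasure.
Context {R : realType} {d : measure_display} {X : measurableType d}.
Variable mu : probability X R.

Lemma pow2_split (e : R) : 0 < e -> forall n, 0 < e / (2 ^ n.+1)%:R.
Proof. by move=> e0 n; rewrite divr_gt0// ltr0n expn_gt0. Qed.

Lemma invS_small (e : R) : 0 < e -> exists n, (n.+1%:R^-1 : R) <= e.
Proof.
move=> e0; exists (Num.trunc e^-1).
rewrite -[leRHS]invrK lef_pV2 ?posrE ?invr_gt0//.
exact/ltW/truncnS_gt.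
Qed.

(** Continuity from above, in the form used to replace a countable union by a
    finite stage of it. *)
Lemma measure_exhaust (A : set X) (F : nat -> set X) (e : R) : 0 < e ->
  measurable A -> (forall n, measurable (F n)) -> nondecreasing_seq F ->
  A `<=` \bigcup_n F n -> exists n, (mu (A `\` F n) <= e%:E)%E.
Proof.
move=> e0 mA mF ndF AF.
have mG n : measurable (A `\` F n) by exact: measurableD.
have cap0 : \bigcap_n (A `\` F n) = set0.
  rewrite -subset0 => x Gx; have [Ax _] := Gx 0%N I.
  by have [n _ Fnx] := AF x Ax; have [_] := Gx n I.
have niG : nonincreasing_seq (fun n => A `\` F n).
  by move=> m n mn; apply/subsetPset; apply: setDS; apply/subsetPset/ndF.
have mcap : measurable (\bigcap_n (A `\` F n)) by rewrite cap0.
have fin0 : (mu (A `\` F 0%N) < +oo)%E.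
  by rewrite (le_lt_trans (probability_le1 _ _))// ltry.
have := nonincreasing_cvg_mu fin0 mG mcap niG.
rewrite cap0 measure0 => cv.
have : \forall n \near \oo, (mu (A `\` F n) < e%:E)%E.
  apply: (cv [set y | (y < e%:E)%E]); apply: open_nbhs_nbhs; split=> /=.
    exact: open_ereal_lt_ereal.
  by rewrite lte_fin.
by move=> [n _ /(_ n (leqnn _)) /ltW ?]; exists n.
Qed.

Lemma measure_le_pow2 (B : set X) (D : nat -> set X) (e : R) : 0 <= e ->
  measurable B -> (forall n, measurable (D n)) -> B `<=` \bigcup_n D n ->
  (forall n, (mu (D n) <= (e / (2 ^ n.+1)%:R)%:E)%E) -> (mu B <= e%:E)%E.
Proof.
move=> e0 mB mD BD De.
apply: le_trans (measure_sigma_subadditive mu mD mB BD) _.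
apply: le_trans (epsilon_trick0 xpredT e0).
by apply: lee_nneseries => [n _ _|n _]; [exact: measure_ge0|exact: De].
Qed.

Lemma measure_le_eps0 (B : set X) : measurable B ->
  (forall e : R, 0 < e -> (mu B <= e%:E)%E) -> mu B = 0%E.
Proof.
move=> mB Be; apply/eqP; rewrite eq_le measure_ge0 andbT.
by apply/lee_addgt0Pr => e e0; rewrite add0e Be.
Qed.

End FiniteMeasure.

Section PolishMeasure.
Context {R : realType} {d : measure_display} {X : measurableType d}.
Variable mu : probability X R.
Context {P : completePseudoMetricType R}.
Variable phi : X -> P.
Hypothesis mphi : forall A, <<s @open P >> A -> measurable (phi @^-1` A).

Lemma preimage_setD (A B : set P) :
  phi @^-1` (A `\` B) = phi @^-1` A `\` phi @^-1` B.
Proof. by []. Qed.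

Lemma open_preimage (A : set P) : open A -> measurable (phi @^-1` A).
Proof. by move=> oA; apply: mphi; apply: sub_gen_smallest. Qed.

Lemma closed_preimage (A : set P) : closed A -> measurable (phi @^-1` A).
Proof.
move=> /closed_openC/open_preimage/measurableC.
by rewrite -preimage_setC setCK.
Qed.

Definition inner_closed (A : set P) := forall e : R, 0 < e ->
  exists F, [/\ closed F, F `<=` A & (mu (phi @^-1` (A `\` F)) <= e%:E)%E].

Lemma inner_closed_closed A : closed A -> inner_closed A.
Proof.
move=> cA e e0; exists A; split => //.
by rewrite setDv preimage_set0 measure0 lee_fin ltW.
Qed.

Lemma inner_closed_bigcap (A : nat -> set P) :
  (forall n, measurable (phi @^-1` A n)) ->
  (forall n, inner_closed (A n)) -> inner_closed (\bigcap_n A n).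
Proof.
move=> mA iA e e0.
have /choice[F FP] n := iA n _ (pow2_split e0 n).
have cF n : closed (F n) by have [] := FP n.
exists (\bigcap_n F n); split.
- exact: closed_bigI.
- by move=> x Fx n _; have [_ + _] := FP n; apply; exact: Fx.
- apply: (@measure_le_pow2 _ _ _ mu _ (fun n => phi @^-1` (A n `\` F n))).
  + exact: ltW.
  + rewrite preimage_setD; apply: measurableD.
      by rewrite preimage_bigcap; exact: bigcapT_measurable.
    by apply: closed_preimage; exact: closed_bigI.
  + by move=> n; rewrite preimage_setD; apply: measurableD => //; exact: closed_preimage.
  + move=> x [Ax /= /existsNP[n /not_implyP[_ nFx]]]; exists n => //; split=> //.
    exact: Ax.
  + by move=> n; have [] := FP n.
Qed.

(** A countable union of closed sets need not be closed, so after
    approximating each piece within e / 2 only finitely many of the closed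
    pieces are kept, at the cost of another e / 2. *)
Lemma inner_closed_bigcup (A : nat -> set P) :
  (forall n, measurable (phi @^-1` A n)) ->
  (forall n, inner_closed (A n)) -> inner_closed (\bigcup_n A n).
Proof.
move=> mA iA e e0.
have e20 : 0 < e / 2 by rewrite divr_gt0.
have /choice[F FP] n := iA n _ (pow2_split e20 n).
have cF n : closed (F n) by have [] := FP n.
pose G n := \big[setU/set0]_(i < n) F i.
have cG n : closed (G n) by exact: closed_bigsetU.
have mU : measurable (phi @^-1` (\bigcup_n F n)).
  rewrite preimage_bigcup; apply: bigcupT_measurable => n; exact: closed_preimage.
have mUA : measurable (phi @^-1` (\bigcup_n A n)).
  by rewrite preimage_bigcup; apply: bigcupT_measurable.
have [N GN] : exists n, (mu (phi @^-1` (\bigcup_n F n) `\` phi @^-1` (G n)) <= (e / 2)%:E)%E.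
  apply: measure_exhaust => //.
  - by move=> n; exact: closed_preimage.
  - move=> m n mn; apply/subsetPset => x; rewrite /G /preimage/=.
    rewrite -!bigcup_mkord => -[i /= im Fi]; exists i => //=.
    exact: leq_trans im mn.
  - move=> x [n _ Fn]; exists n.+1 => //; rewrite /G /preimage/= -bigcup_mkord.
    by exists n => //=.
exists (G N); split => //.
  move=> x; rewrite /G -bigcup_mkord => -[i _ Fi]; exists i => //.
  by have [_ + _] := FP i; apply.
have m1 : measurable (phi @^-1` (\bigcup_n A n `\` \bigcup_n F n)).
  by rewrite preimage_setD; exact: measurableD.
have m2 : measurable (phi @^-1` (\bigcup_n F n) `\` phi @^-1` (G N)).
  by apply: measurableD => //; exact: closed_preimage.
apply: (@le_trans _ _ (mu (phi @^-1` (\bigcup_n A n `\` \bigcup_n F n)) +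
    mu (phi @^-1` (\bigcup_n F n) `\` phi @^-1` (G N)))%E).
  apply: le_trans (measureU2 _ m1 m2).
  apply: le_measure; rewrite ?inE.
  - by rewrite preimage_setD; apply: measurableD => //; exact: closed_preimage.
  - exact: measurableU.
  - move=> x [Ax nG]; have [Fx|nF] := pselect ((\bigcup_n F n) (phi x)).
      by right.
    by left.
rewrite [e](splitr e) EFinD; apply: leeD => //.
apply: (@measure_le_pow2 _ _ _ mu _ (fun n => phi @^-1` (A n `\` F n))) => //.
- exact: ltW.
- by move=> n; rewrite preimage_setD; apply: measurableD => //; exact: closed_preimage.
- move=> x [[n _ Ax] nF]; exists n => //; split=> // Fx.
  by apply: nF; exists n.
- by move=> n; have [] := FP n.
Qed.

(** An open set is the increasing union of the closed sets of points that are
    not within 1 / (n + 1) of its complement. Interiors are taken because the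
    balls of a pseudometric structure need not be open. *)
Lemma inner_closed_open U : open U -> inner_closed U.
Proof.
move=> oU.
pose F n := ~` (\bigcup_(y in ~` U) (ball y (n.+1%:R^-1 : R))°).
have cF n : closed (F n).
  by rewrite closedC; apply: bigcup_open => y _; exact: open_interior.
have <- : \bigcup_n F n = U.
  apply/seteqP; split => [x [n _ Fx]|x Ux].
    apply: contrapT => nU; apply: Fx; exists x => //.
    by apply: nbhsx_ballx; rewrite invr_gt0.
  have /nbhs_ballP[e /= e0 eU] : nbhs x U by exact: open_nbhs_nbhs.
  have [n ne] := invS_small e0.
  exists n => // -[y nUy /interior_subset /ball_sym xy]; apply: nUy; apply: eU.
  exact: le_ball xy.
apply: inner_closed_bigcup.
- by move=> n; exact: closed_preimage.
- by move=> n; exact: inner_closed_closed.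
Qed.

(** The sets that are inner regular together with their complement form a
    sigma-algebra, by stability under countable intersections and unions; it
    contains the open sets. *)
Lemma inner_closed_borel A : <<s @open P >> A -> inner_closed A.
Proof.
move=> sA; pose C := [set B | [/\ <<s @open P >> B, inner_closed B &
  inner_closed (~` B)]].
suff : C A by case.
have sP := @smallest_sigma_algebra P setT (@open P).
case: (sP) => s0 sC sU.
move: A sA; apply: smallest_sub; last first.
  move=> U oU; split; first exact: sub_gen_smallest.
    exact: inner_closed_open.
  by apply: inner_closed_closed; rewrite closedC.
split.
- split=> //; first exact/inner_closed_closed/closed0.
  by rewrite setC0; exact/inner_closed_closed/closedT.
- by move=> B [sB iB iCB]; split; rewrite setTD// ?setCK//; rewrite -setTD; exact: sC.
- move=> B CB; split.
  + by apply: sU => n; case: (CB n).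
  + apply: inner_closed_bigcup => n; case: (CB n) => // sB _ _; exact: mphi.
  + rewrite setC_bigcup; apply: inner_closed_bigcap => n; case: (CB n) => // sB _ _.
    by rewrite preimage_setC; apply: measurableC; exact: mphi.
Qed.


Context (S : set P).
Hypothesis cS : countable S.
Hypothesis dS : dense S.

Lemma dense_enum : exists s : nat -> P,
  forall (x : P) (r : R), 0 < r -> exists n, ball (s n) r x.
Proof.
have [c cinj] := countable_injP _ cS.
exists (fun n => xget point [set p | S p /\ c p = n]) => x r r0.
have [p [/interior_subset xp Sp]] : (ball x r)° `&` S !=set0.
  apply: dS; last exact: open_interior.
  by exists x; exact: nbhsx_ballx.
exists (c p); have -> : xget point [set q | S q /\ c q = c p] = p.
  case: xgetP => [q _ [Sq cq]|/(_ p)]; last by case.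
  by apply: cinj => //; rewrite inE.
exact: ball_sym.
Qed.

Lemma countable_basis : exists U : nat -> set P, (forall n, open (U n)) /\
  forall x B, nbhs x B -> exists2 n, U n x & U n `<=` B.
Proof.
have [s sP] := dense_enum.
pose r n : R := n.+1%:R^-1.
have r0 n : 0 < r n by rewrite invr_gt0.
(* basic open sets are indexed by the code of a pair (center, radius) *)
pose ix n : nat * nat := odflt (0%N, 0%N) (unpickle n).
exists (fun n => (ball (s (ix n).1) (r (ix n).2 + r (ix n).2))°).
split=> [n|x B /nbhs_ballP[q /= q0 qB]]; first exact: open_interior.
have q40 : 0 < q / 2 / 2 by rewrite !divr_gt0.
have [m qm] := invS_small q40.
have q2 : r m + r m <= q / 2 by rewrite [q / 2]splitr lerD.
have [j sj] := sP x _ (r0 m).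
exists (pickle (j, m)); rewrite /ix pickleK/=.
  by apply/nbhs_ballP; exists (r m) => //= z hz; exact: ball_triangle sj hz.
move=> z /interior_subset sz; apply: qB.
apply: (@le_ball _ _ _ (r m + (r m + r m))).
  by rewrite [q]splitr lerD//; apply: le_trans q2; rewrite lerDl ltW.
exact: ball_triangle (ball_sym sj) sz.
Qed.

Lemma closure_ball_subset (x : P) (r : R) : 0 < r ->
  closure (ball x r) `<=` ball x (r + r).
Proof.
move=> r0 y /(_ _ (nbhsx_ballx y r r0)) [z [xz yz]].
by apply: ball_triangle xz _; exact: ball_sym.
Qed.

(** An ultrafilter containing a finite union of balls contains one of them, so
    on a totally bounded set every ultrafilter is Cauchy. *)
Lemma compact_totally_bounded (K : set P) : closed K ->
  (forall r : R, 0 < r -> exists s : nat -> P, exists n : nat,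
     K `<=` \bigcup_(i < n) ball (s i) r) -> compact K.
Proof.
move=> cK tK; rewrite compact_ultra => F FU FK.
have FF : ProperFilter F by exact: ultra_proper.
have cauF : cauchy F.
  apply: cauchy_exP => r r0; have [s [n Ks]] := tK r r0.
  have {Ks} : F (\bigcup_(i < n) ball (s i) r) by exact: filterS FK.
  elim: n => [|n IH].
    rewrite bigcup_mkord big_ord0 => /filter_not_empty; exact: False_ind.
  move=> Fn.
  have [Fb|Fb] := in_ultra_setVsetC (ball (s n) r) FU; first by exists (s n).
  apply: IH; apply: (filterS _ (filterI Fn Fb)) => x [[i /= + xi] nx].
  by rewrite ltnS leq_eqVlt => /orP[/eqP ein|]; [rewrite ein in xi|exists i].
have Fp : F --> lim F := cauchy_cvg F cauF.
exists (lim F); split; last exact: Fp.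
apply: cK => B /Fp FB.
have FKB : F (K `&` B) := @filterI _ F FF K B FK FB.
by have [x ?] := @filter_ex _ F FF _ FKB; exists x.
Qed.

(** Ulam: for each radius finitely many balls cover all but a small part of
    the space; the intersection over a sequence of radii is closed and totally
    bounded. *)
Lemma tight (e : R) : 0 < e -> exists T : set P,
  [/\ closed T, compact T & (mu (phi @^-1` (~` T)) <= e%:E)%E].
Proof.
move=> e0; have [s sP] := dense_enum.
pose r n : R := n.+1%:R^-1.
have r0 n : 0 < r n by rewrite invr_gt0.
pose c n i := closure (ball (s i) (r n)).
pose D n k := \big[setU/set0]_(i < k) c n i.
have cD n k : closed (D n k).
  by apply: closed_bigsetU => i _; exact: closed_closure.
have /choice[k kP] n : exists k, (mu (setT `\` phi @^-1` (D n k)) <=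
    (e / (2 ^ n.+1)%:R)%:E)%E.
  apply: measure_exhaust => //.
  - exact: pow2_split.
  - by move=> k; exact: closed_preimage.
  - move=> a b ab; apply/subsetPset => x; rewrite /D /preimage/=.
    rewrite -!bigcup_mkord => -[i /= im Fi]; exists i => //=.
    exact: leq_trans im ab.
  - move=> x _; have [i si] := sP (phi x) _ (r0 n).
    exists i.+1 => //; rewrite /D /preimage/= -bigcup_mkord.
    by exists i => //=; exact: subset_closure.
have cT : closed (\bigcap_n D n (k n)) by exact: closed_bigI.
exists (\bigcap_n D n (k n)); split=> //.
  apply: compact_totally_bounded => // q q0.
  have [n nq] : exists n, r n + r n <= q.
    have q20 : 0 < q / 2 by rewrite divr_gt0.
    have [n qn] := invS_small q20; exists n.
    by rewrite [q]splitr lerD.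
  exists s, (k n) => x /(_ n I); rewrite /D -bigcup_mkord => -[i /= ik xi].
  exists i => //; apply: le_ball nq _ _; exact: closure_ball_subset.
apply: (@measure_le_pow2 _ _ _ mu _ (fun n => setT `\` phi @^-1` (D n (k n)))) => //.
- exact: ltW.
- by apply: open_preimage; exact: closed_openC.
- by move=> n; apply: measurableD => //; exact: closed_preimage.
- by move=> x /= /existsNP[n /not_implyP[_ nD]]; exists n.
Qed.

(** Lusin: for every basic open set U, both h^-1 U and its complement are
    replaced by closed subsets; on the points kept for all U, the preimage of U
    is relatively open. *)
Lemma compact_continuous_approx (h : P -> P) (A : set P) (e : R) : 0 < e ->
  (forall U, open U -> <<s @open P >> (h @^-1` U)) ->
  <<s @open P >> A ->
  exists K : set P, [/\ compact K, K `<=` A,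
    (mu (phi @^-1` (A `\` K)) <= e%:E)%E & {within K, continuous h}].
Proof.
move=> e0 mh sA; have [U [oU basisU]] := countable_basis.
pose V n := h @^-1` U n.
have sV n : <<s @open P >> (V n) by apply: mh; exact: oU.
have sVC n : <<s @open P >> (~` V n).
  by rewrite -setTD; have [_ + _] := @smallest_sigma_algebra P setT (@open P); apply; exact: sV.
(* the first two terms of the geometric series are spent on A and on T *)
have pe n : 0 < e / (2 ^ n.+3)%:R / 2 by rewrite divr_gt0// divr_gt0// ltr0n expn_gt0.
have /choice[F FP] n := inner_closed_borel (sV n) (pe n).
have /choice[G GP] n := inner_closed_borel (sVC n) (pe n).
have cF n : closed (F n) by have [] := FP n.
have cG n : closed (G n) by have [] := GP n.
have [FA [cFA FAA FAe]] := inner_closed_borel sA (pow2_split e0 0).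
have [T [clT cT Te]] := tight (pow2_split e0 1).
pose C n := F n `|` G n.
have cC n : closed (C n) by exact: closedU.
have mC n : measurable (phi @^-1` (~` C n)).
  by apply: open_preimage; exact: closed_openC.
have mT : measurable (phi @^-1` (~` T)).
  by apply: open_preimage; exact: closed_openC.
have clK : closed (T `&` (FA `&` \bigcap_n C n)).
  by apply: closedI => //; apply: closedI => //; exact: closed_bigI.
have mA : measurable (phi @^-1` (A `\` FA)).
  by rewrite preimage_setD; apply: measurableD; [exact: mphi|exact: closed_preimage].
exists (T `&` (FA `&` \bigcap_n C n)); split.
- by apply: subclosed_compact clK cT _ => x [].
- by move=> x [_ [+ _]]; exact: FAA.
- pose D n := match n with 0%N => phi @^-1` (A `\` FA)
    | 1%N => phi @^-1` (~` T) | n.+2 => phi @^-1` (~` C n) end.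
  apply: (@measure_le_pow2 _ _ _ mu _ D).
  + exact: ltW.
  + by rewrite preimage_setD; apply: measurableD; [exact: mphi|exact: closed_preimage].
  + by case=> [|[|n]]; [exact: mA|exact: mT|exact: mC].
  + move=> x [Ax nK]; apply: contrapT => nD; apply: nK; split.
      by apply: contrapT => nT; apply: nD; exists 1%N.
    split; first by apply: contrapT => nF; apply: nD; exists 0%N.
    by move=> n _; apply: contrapT => nC; apply: nD; exists n.+2.
  + move=> [|[|n]] //=.
    rewrite [e / _]splitr EFinD.
    apply: (@le_trans _ _ (mu (phi @^-1` (V n `\` F n)) +
      mu (phi @^-1` (~` V n `\` G n)))%E); last first.
      by apply: leeD; [have [] := FP n|have [] := GP n].
    have m1 : measurable (phi @^-1` (V n `\` F n)).
      by rewrite preimage_setD; apply: measurableD; [exact: mphi|exact: closed_preimage].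
    have m2 : measurable (phi @^-1` (~` V n `\` G n)).
      by rewrite preimage_setD; apply: measurableD; [exact: mphi|exact: closed_preimage].
    apply: le_trans (measureU2 _ m1 m2); apply: le_measure; rewrite ?inE//.
      exact: measurableU.
    move=> x /not_orP[nF nG]; have [Vx|nV] := pselect (V n (phi x)).
      by left.
    by right.
- apply/subspace_continuousP => x [Tx [FAx Cx]] B /basisU[n Ux UB].
  have nGx : ~ G n x by move=> Gx; have [_ /(_ x Gx)] := GP n.
  rewrite /nbhs/= /within/=.
  have : nbhs x (~` G n).
    by apply: open_nbhs_nbhs; split=> //; exact: closed_openC.
  apply: filterS => z nGz [_ [_ /(_ n I) [Fz|//]]]; apply: UB.
  by have [_ /(_ z Fz)] := FP n.
Qed.

End PolishMeasure.

Section Images.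
Context {R : realType} {d : measure_display} {X : measurableType d}.
Variable mu : probability X R.
Hypothesis hX : standard_borel R X.

(** The image of a Borel set is Borel up to the image of a null set: exhaust
    A, up to a null set M, by countably many compact sets on which g is
    continuous; their images are compact. *)
Lemma image_mod_null (g : X -> X) (A : set X) :
  measurable_fun setT g -> measurable A ->
  exists B M : set X, [/\ measurable B, B `<=` g @` A, measurable M, mu M = 0%E &
    g @` A `<=` B `|` g @` (A `&` M)].
Proof.
move=> mg mA; have [P [phi [hP [S cS dS] [psi phiK psiK] borel]]] := hX.
have im_pre (B : set P) : phi @` (phi @^-1` B) = B.
  apply/seteqP; split=> [_ [x Bx <-]//|y By].
  by exists (psi y); rewrite /preimage/= psiK.
have pre_im (B : set X) : phi @^-1` (phi @` B) = B.
  apply/seteqP; split=> [x [y By /(can_inj phiK) <-]//|x Bx].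
  by exists x.
have mphi B : <<s @open P >> B -> measurable (phi @^-1` B).
  by move=> sB; apply/borel; rewrite im_pre.
pose h := phi \o g \o psi.
have mh U : open U -> <<s @open P >> (h @^-1` U).
  move=> oU.
  have -> : h @^-1` U = phi @` (g @^-1` (phi @^-1` U)).
    apply/seteqP; split=> [y Uy|_ [x Ux <-]].
      by exists (psi y); rewrite ?psiK.
    by rewrite /h /preimage/= phiK.
  apply/borel; rewrite -[g @^-1` _]setTI; apply: mg => //.
  by apply: mphi; exact: sub_gen_smallest.
have sA : <<s @open P >> (phi @` A) by apply/borel.
have e0 n : 0 < (n.+1%:R^-1 : R) by rewrite invr_gt0.
have /choice[K KP] n := compact_continuous_approx mu mphi cS dS (e0 n) mh sA.
have mgK n : measurable (g @` (phi @^-1` K n)).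
  apply/borel.
  have -> : phi @` (g @` (phi @^-1` K n)) = h @` K n.
    apply/seteqP; split=> [_ [_ [x Kx <-] <-]|_ [y Ky <-]].
      by exists (phi x) => //; rewrite /h/= phiK.
    by exists (g (psi y)) => //; exists (psi y) => //; rewrite /preimage/= psiK.
  have cl : closed (h @` K n).
    have [cK _ _ ch] := KP n.
    by apply: compact_closed => //; exact: continuous_compact.
  have [_ sC _] := @smallest_sigma_algebra P setT (@open P).
  rewrite -(setCK (h @` K n)) -setTD; apply: sC; apply: sub_gen_smallest.
  exact: closed_openC.
have mK n : measurable (phi @^-1` K n).
  apply: closed_preimage => //; apply: compact_closed => //.
  by have [] := KP n.
have mM : measurable (A `\` \bigcup_n (phi @^-1` K n)).
  by apply: measurableD => //; exact: bigcupT_measurable.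
exists (\bigcup_n (g @` (phi @^-1` K n))), (A `\` \bigcup_n (phi @^-1` K n)).
split=> //.
- exact: bigcupT_measurable.
- move=> y [n _ [x Kx <-]]; exists x => //.
  have [_ /(_ _ Kx) [z Az /(can_inj phiK) <-//]] := KP n.
- apply: measure_le_eps0 => // e /invS_small[n ne].
  have [_ _ Ke _] := KP n.
  have mD : measurable (phi @^-1` (phi @` A `\` K n)).
    by rewrite preimage_setD pre_im; exact: measurableD.
  apply: (@le_trans _ _ (mu (phi @^-1` (phi @` A `\` K n)))).
    apply: le_measure; rewrite ?inE// => x [Ax nK]; split; first by exists x.
    by move=> Kx; apply: nK; exists n.
  by apply: le_trans Ke _; rewrite lee_fin.
- move=> _ [x Ax <-].
  have [Kx|nK] := pselect ((\bigcup_n phi @^-1` K n) x); last first.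
    by right; exists x.
  by left; have [n _ Kn] := Kx; exists n => //; exists x.
Qed.

(** A countable basis of the Polish topology separates points. *)
Lemma separating_family : exists D : nat -> set X,
  (forall n, measurable (D n)) /\
  forall x y, (forall n, D n x <-> D n y) -> x = y.
Proof.
have [P [phi [hP [S cS dS] [psi phiK psiK] borel]]] := hX.
have im_pre (B : set P) : phi @` (phi @^-1` B) = B.
  apply/seteqP; split=> [_ [x Bx <-]//|y By].
  by exists (psi y); rewrite /preimage/= psiK.
have [U [oU basisU]] := countable_basis cS dS.
exists (fun n => phi @^-1` U n); split.
  by move=> n; apply/borel; rewrite im_pre; apply: sub_gen_smallest.
move=> x y xy; apply: (can_inj phiK); apply: (@hP (phi x) (phi y)) => A B.
move=> /basisU[n Ux UA] nB; exists (phi y); split; last exact: nbhs_singleton.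
by apply: UA; apply/(xy n).
Qed.

(** Two points are equal exactly when they lie in the same sets of a countable
    separating family, which writes the set as a countable combination of
    measurable rectangles. *)
Lemma measurable_diag (g h : X -> X) : measurable_fun setT g ->
  measurable_fun setT h -> measurable [set z : X * X | g z.1 = h z.2].
Proof.
move=> mg mh; have [D [mD sep]] := separating_family.
have m1 n : measurable [set z : X * X | D n (g z.1)].
  have -> : [set z : X * X | D n (g z.1)] = setT `&` (g \o fst) @^-1` D n.
    by rewrite setTI.
  by apply: (measurableT_comp mg (@measurable_fst _ _ X X)).
have m2 n : measurable [set z : X * X | D n (h z.2)].
  have -> : [set z : X * X | D n (h z.2)] = setT `&` (h \o snd) @^-1` D n.
    by rewrite setTI.
  by apply: (measurableT_comp mh (@measurable_snd _ _ X X)).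
have -> : [set z : X * X | g z.1 = h z.2] =
    \bigcap_n ([set z : X * X | D n (g z.1)] `&` [set z | D n (h z.2)] `|`
      ~` [set z | D n (g z.1)] `&` ~` [set z | D n (h z.2)]).
  apply/seteqP; split=> [z /= e n _|z Dz].
    by rewrite /= e; have [?|?] := pselect (D n (h z.2)); [left|right].
  by apply: sep => n; split=> H; case: (Dz n I) => -[].
apply: bigcapT_measurable => n; apply: measurableU; apply: measurableI => //;
  exact: measurableC.
Qed.

End Images.

(** * Lower integrals *)

Section LowerIntegral.
Import HBNNSimple.
Context {R : realType} {d : measure_display} {X : measurableType d}.
Variable mu : probability X R.

(** The integral of a nonnegative function is by definition a supremum over
    the simple functions below it, hence monotone on arbitrary nonnegative
    functions. The sums over back orbits appearing below are measurable only
    off a null set, and this is all that is known of them when they are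
    integrated. *)
Lemma ge0_le_integralT (F G : X -> \bar R) :
  (forall x, 0 <= F x)%E -> (forall x, F x <= G x)%E ->
  (\int[mu]_x F x <= \int[mu]_x G x)%E.
Proof.
move=> F0 FG; have G0 x : (0 <= G x)%E by exact: le_trans (F0 x) (FG x).
rewrite !ge0_integralTE//; apply: le_ereal_sup => _ [h hF <-]; exists h => //= x.
exact: le_trans (hF x) (FG x).
Qed.

Lemma integral_le_cst (F : X -> \bar R) (N : set X) (c : R) :
  (forall x, 0 <= F x)%E -> measurable N -> mu N = 0%E -> 0 <= c ->
  (forall x, ~ N x -> F x <= c%:E)%E -> (\int[mu]_x F x <= c%:E)%E.
Proof.
move=> F0 mN N0 c0 Fc; rewrite ge0_integralTE//.
apply: ge_ereal_sup => _ [h hF <-]; rewrite -integralT_nnsfun.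
apply: (@le_trans _ _ (\int[mu]_x (cst c%:E x))%E); last first.
  by rewrite integral_cst//= probability_setT mule1.
apply: ae_ge0_le_integral => //.
- move=> x _ /=; rewrite lee_fin; exact: fun_ge0.
- by apply/measurable_EFinP.
exists N; split=> // x /= nx; apply: contrapT => Nx; apply: nx => _.
exact: le_trans (hF x) (Fc x Nx).
Qed.

Lemma ae_of_null (P : X -> Prop) (N : set X) : measurable N -> mu N = 0%E ->
  (forall x, ~ N x -> P x) -> {ae mu, forall x, P x}.
Proof.
by move=> mN N0 NP; exists N; split=> // x nP; apply: contrapT => /NP.
Qed.

Lemma integral_lty_ae (F : X -> \bar R) : measurable_fun setT F ->
  (forall x, 0 <= F x)%E -> (\int[mu]_x F x < +oo)%E ->
  {ae mu, forall x, (F x < +oo)%E}.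
Proof.
move=> mF F0 Foo; have iF : mu.-integrable setT F.
  by apply/integrableP; split=> //; under eq_integral do rewrite gee0_abs//.
have := integrable_ae measurableT iF; apply: filterS => x /(_ I).
by rewrite ge0_fin_numE.
Qed.

End LowerIntegral.

(** * Invariant null sets and measurability along orbits *)

Section MeasurableDomains.
Context {R : realType} {d : measure_display} {X : measurableType d}.

(** Only rational thresholds are allowed, because below each threshold costs a
    null set and these can be discarded together only if they are countably
    many. *)
Lemma measurable_fun_rat_rays (D : set X) (g : X -> \bar R) : measurable D ->
  (forall q : rat, measurable (D `&` [set x | ((ratr q)%:E < g x)%E])) ->
  measurable_fun D g.
Proof.
move=> mD gq _; apply: (measurability _ (ErealGenOInfty.measurableE R)) => //.
move=> _ [_ [t ->] <-].
have -> : D `&` g @^-1` `]t%:E, +oo[ =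
    \bigcup_(q in [set q : rat | t <= ratr q])
      (D `&` [set x | ((ratr q)%:E < g x)%E]).
  apply/seteqP; split=> [x [Dx]|x [q /= tq [Dx qg]]]; last first.
    by split=> //=; rewrite in_itv/= andbT (le_lt_trans _ qg)// lee_fin.
  rewrite /= in_itv/= andbT => tg.
  have [q tq qg] : exists2 q : rat, t <= ratr q & ((ratr q)%:E < g x)%E.
    have [s ts sg] : exists2 s : R, t < s & (s%:E <= g x)%E.
      case: (g x) tg => [r| |]; rewrite ?lte_fin// => tr; first by exists r.
      by exists (t + 1); rewrite ?ltrDl// leey.
    have [q] := rat_in_itvoo ts; rewrite in_itv/= => /andP[tq qs].
    exists q; first exact: ltW.
    by apply: lt_le_trans sg; rewrite lte_fin.
  by exists q.
rewrite bigcup_mkcond; apply: bigcupT_measurable_rat => q.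
by case: ifP => // _; exact: gq.
Qed.

Lemma measurable_setDS (A B C : set X) : measurable C -> B `<=` C ->
  measurable (A `\` B) -> measurable (A `\` C).
Proof. by move=> mC /setUidr <-; rewrite -setDDl => ?; exact: measurableD. Qed.

Lemma measurable_funCS d' (Y : measurableType d') (B C : set X) (g : X -> Y) :
  measurable B -> B `<=` C -> measurable_fun (~` B) g -> measurable_fun (~` C) g.
Proof.
move=> mB BC; apply: measurable_funS; first exact: measurableC.
exact: subsetC.
Qed.

End MeasurableDomains.

Section NullSets.
Context {R : realType} {d : measure_display} {X : measurableType d}.
Variables (mu : probability X R) (f : X -> X).
Hypothesis hX : standard_borel R X.
Hypothesis mf : measurable_fun setT f.
Hypothesis mcp : measure_class_preserving mu (orbit_rel f).

Definition invariant_null (N : set X) : Prop :=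
  [/\ measurable N, mu N = 0%E & invariant_set (orbit_rel f) N].

(** Alternate the saturation, which preserves null sets, with the passage to
    a measurable null superset. *)
Lemma invariant_null_hull (A : set X) : mu.-negligible A ->
  exists2 N, invariant_null N & A `<=` N.
Proof.
move=> nA.
have /choice[s sP] (B : set X) : exists C, mu.-negligible B ->
    [/\ measurable C, mu C = 0%E & saturation (orbit_rel f) B `<=` C].
  have [/mcp [C [mC C0 BC]]|nB] := pselect (mu.-negligible B).
    by exists C.
  by exists set0.
pose F n := iter n s A.
have negF n : mu.-negligible (F n).
  elim: n => [//|n IH]; have [mC C0 _] := sP _ IH.
  by apply/negligibleP.
have FS n : F n `<=` F n.+1.
  move=> x Fx; have [_ _] := sP _ (negF n); apply.
  by exists x => //; exact: orbit_rel_refl.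
have FP n : [/\ measurable (F n.+1), mu (F n.+1) = 0%E &
   saturation (orbit_rel f) (F n) `<=` F n.+1] := sP _ (negF n).
exists (\bigcup_n F n.+1).
  split.
  - by apply: bigcupT_measurable => n; have [] := FP n.
  - apply: measure_negligible.
      by apply: bigcupT_measurable => n; have [] := FP n.
    by apply: negligible_bigcup => n; exact: negF.
  - move=> x y Exy [n _ Fx]; exists n.+1 => //.
    by have [_ _] := FP n.+1; apply; exists x.
by move=> x Ax; exists 0%N => //; exact: (FS 0%N).
Qed.

Lemma invariant_null_bigcup (N : nat -> set X) :
  (forall n, invariant_null (N n)) -> invariant_null (\bigcup_n N n).
Proof.
move=> iN; have mN n : measurable (N n) by case: (iN n).
split; first exact: bigcupT_measurable.
  apply: measure_negligible; first exact: bigcupT_measurable.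
  by apply: negligible_bigcup => n; apply/negligibleP => //; case: (iN n).
by move=> x y Exy [n _ Nx]; exists n => //; case: (iN n) => _ _; apply; eauto.
Qed.

(** Countably many properties, each valid off some invariant null set and
    stable under enlarging it, hold off a common one. *)
Lemma invariant_null_choice (T : countType) (Q : T -> set X -> Prop) :
  (forall t, exists2 N, invariant_null N & Q t N) ->
  (forall t N N', invariant_null N -> invariant_null N' -> N `<=` N' ->
    Q t N -> Q t N') ->
  exists2 N, invariant_null N & forall t, Q t N.
Proof.
move=> ex mono.
have /choice[N NP] n : exists N, invariant_null N /\
    forall t : T, unpickle n = Some t -> Q t N.
  case: (unpickle n) => [t|].
    by have [N iN QN] := ex t; exists N; split=> // _ [<-].
  exists set0; split=> //; split=> //; exact: measure0.
have iN : invariant_null (\bigcup_n N n).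
  by apply: invariant_null_bigcup => n; case: (NP n).
exists (\bigcup_n N n) => // t.
apply: (mono t (N (pickle t))) => //.
- by case: (NP (pickle t)).
- by move=> x Nx; exists (pickle t).
by have [_] := NP (pickle t); apply; rewrite pickleK.
Qed.

Lemma invariant_null2 (Q1 Q2 : set X -> Prop) :
  (exists2 N, invariant_null N & Q1 N) ->
  (exists2 N, invariant_null N & Q2 N) ->
  (forall N N', invariant_null N -> invariant_null N' -> N `<=` N' ->
    Q1 N -> Q1 N') ->
  (forall N N', invariant_null N -> invariant_null N' -> N `<=` N' ->
    Q2 N -> Q2 N') ->
  exists2 N, invariant_null N & Q1 N /\ Q2 N.
Proof.
move=> e1 e2 m1 m2.
have [|t N N' iN iN' NN'|N iN QN] :=
    @invariant_null_choice bool (fun b => if b then Q1 else Q2).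
- by case.
- by case: t; [exact: m1|exact: m2].
- by exists N => //; split; [exact: (QN true)|exact: (QN false)].
Qed.

Lemma invariant_nullC_iter N n x : invariant_null N -> ~ N x -> ~ N (iter n f x).
Proof.
move=> [_ _ iN] nx Nf; apply: nx; apply: iN Nf.
by apply: orbit_rel_sym; exact: orbit_rel_iter.
Qed.

Lemma ae_invariant_null (P : X -> Prop) : {ae mu, forall x, P x} ->
  exists2 N, invariant_null N & forall x, ~ N x -> P x.
Proof.
move=> /invariant_null_hull[N iN PN]; exists N => // x nN.
by apply: contrapT => nP; apply: nN; exact: PN.
Qed.

Lemma measurable_iter n : measurable_fun setT (iter n f).
Proof.
elim: n => [|n IH]; first exact: measurable_id.
exact: (measurableT_comp mf IH).
Qed.

Lemma measurable_preimage_iter n (A : set X) : measurable A ->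
  measurable (iter n f @^-1` A).
Proof. by move=> mA; rewrite -[X in measurable X]setTI; exact: measurable_iter. Qed.

(** The exceptional part of the image lies in the saturation of a null set. *)
Lemma image_iter_measurable n (A : set X) : measurable A ->
  exists2 N, invariant_null N & measurable (iter n f @` A `\` N).
Proof.
move=> mA; have [B [M [mB BA mM M0 AB]]] := image_mod_null mu hX (measurable_iter n) mA.
have [|N iN MN] := @invariant_null_hull M; first exact/negligibleP.
exists N => //.
have -> : iter n f @` A `\` N = B `\` N.
  apply/seteqP; split=> [y [/AB[By|[x [Ax Mx] xy]] nN]|y [By nN]].
  - by split.
  - exfalso; apply: nN; rewrite -xy.
    by case: iN => _ _ /(_ x); apply; [exact: orbit_rel_iter|exact: MN].
  - by split=> //; exact: BA.
by apply: measurableD => //; case: iN.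
Qed.

Lemma measurable_orbit_rel :
  measurable [set z : X * X | orbit_rel f z.1 z.2].
Proof.
have -> : [set z : X * X | orbit_rel f z.1 z.2] =
    \bigcup_m \bigcup_n [set z : X * X | iter m f z.1 = iter n f z.2].
  apply/seteqP; split=> [z /= /orbit_relP[m [n e]]|z [m _ [n _ e]]].
    by exists m => //; exists n.
  by apply/orbit_relP; exists m, n.
apply: bigcupT_measurable => m; apply: bigcupT_measurable => n.
by apply: (measurable_diag hX); exact: measurable_iter.
Qed.

Lemma measurable_back_orbit :
  measurable [set z : X * X | back_orbit f z.2 z.1].
Proof.
have -> : [set z : X * X | back_orbit f z.2 z.1] =
    \bigcup_n [set z : X * X | iter n f z.1 = iter 0 f z.2].
  by apply/seteqP; split=> [z [n e]|z [n _ e]]; exists n.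
apply: bigcupT_measurable => n.
by apply: (measurable_diag hX); exact: measurable_iter.
Qed.

Lemma measurable_along_orbit d' (Y : measurableType d') (w : X * X -> Y) n :
  measurable_fun [set z : X * X | orbit_rel f z.1 z.2] w ->
  measurable_fun setT (fun y => w (y, iter n f y)).
Proof.
move=> mw _ B mB; rewrite setTI.
have mg : measurable_fun setT (fun y => (y, iter n f y)).
  by apply: measurable_fun_pair => //; exact: measurable_iter.
have := mg measurableT _ (mw measurable_orbit_rel _ mB); rewrite setTI.
congr measurable; apply/seteqP; split=> [y []//|y By]; split=> //=.
exact: orbit_rel_iter.
Qed.

End NullSets.

(** * Unordered sums *)

Section Esum.
Import finmap.
Context {R : realType} {T : choiceType}.
Implicit Types (I J : set T) (a : T -> \bar R).

Lemma subset_esum I J a : I `<=` J ->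
  (\esum_(i in I) a i <= \esum_(i in J) a i)%E.
Proof.
move=> IJ; apply: le_ereal_sup => _ [F [finF FI] <-]; exists F => //.
by split=> //; exact: subset_trans IJ.
Qed.

Lemma esum_scale_le I a (c : R) : 0 <= c -> (forall i, I i -> 0 <= a i)%E ->
  (\esum_(i in I) (c%:E * a i) <= c%:E * \esum_(i in I) a i)%E.
Proof.
move=> c0 a0; apply: ge_ereal_sup => _ [F [finF FI] <-].
apply: (@le_trans _ _ (c%:E * \sum_(i \in F) a i)%E).
  rewrite !fsbig_finite//= big_seq [X in (_ <= _ * X)%E]big_seq ge0_sume_distrr// => i.
  by rewrite in_fset_set// => /set_mem/FI/a0.
apply: lee_wpmul2l; rewrite ?lee_fin//.
by apply: ereal_sup_ubound; exists F.
Qed.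

Lemma esum_lty_finite I a (r : R) : 0 < r -> (forall i, I i -> 0 <= a i)%E ->
  (\esum_(i in I) a i < +oo)%E ->
  finite_set [set i | I i /\ (r%:E <= a i)%E].
Proof.
move=> r0 a0 aoo; apply: contrapT => inf.
have S0 : (0 <= \esum_(i in I) a i)%E by exact: esum_ge0.
have [n nS] : exists n, (\esum_(i in I) a i < (n%:R * r)%:E)%E.
  exists (Num.trunc (fine (\esum_(i in I) a i) / r)).+1.
  rewrite -[X in (X < _)%E]fineK ?ge0_fin_numE// lte_fin -ltr_pdivrMr//.
  exact: truncnS_gt.
have [B BI nB] := infinite_set_fset n inf.
move: nS; apply/negP; rewrite -leNgt.
apply: esum_ge; exists [set` B].
  by split=> [|i /BI[]//]; exact: finite_fset.
rewrite fsbig_finite//= set_fsetK.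
apply: (@le_trans _ _ (\sum_(i <- B) r%:E)%E); last first.
  by rewrite big_seq [leRHS]big_seq; apply: lee_sum => i iB; have [] := BI i iB.
rewrite sumEFin lee_fin big_const_seq count_predT iter_addr addr0 -[leRHS]mulr_natl.
by apply: ler_wpM2r; [exact: ltW|rewrite ler_nat].
Qed.

Lemma esum_adherent I a (e : R) : 0 < e -> (forall i, I i -> 0 <= a i)%E ->
  (\esum_(i in I) a i < +oo)%E ->
  exists F, [/\ finite_set F, F `<=` I &
    (\esum_(i in I) a i <= \esum_(i in F) a i + e%:E)%E].
Proof.
move=> e0 a0 aoo; have S0 : (0 <= \esum_(i in I) a i)%E by exact: esum_ge0.
have [|_ [F [finF FI] <-] FS] := @ub_ereal_sup_adherent R
    [set (\sum_(i \in A) a i)%E | A in fsets I] e e0.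
  by rewrite -[ereal_sup _]/(esum I a) ge0_fin_numE.
exists F; split=> //; rewrite [X in (_ <= X + _)%E]esum_fset//; last first.
  by move=> i /set_mem Fi; apply: a0; exact: FI.
by rewrite -leeBlDr//; exact: ltW.
Qed.

End Esum.

Section EsumTail.
Context {R : realType} {T : choiceType}.
Implicit Types (I : set T) (a : T -> R).

(** The part of a value r that is counted when only values less than
    1 / (n + 1) are retained. *)
Definition below (n : nat) (r : R) : \bar R := if r < n.+1%:R^-1 then r%:E else 0%E.

Lemma below_ge0 n r : 0 <= r -> (0 <= below n r)%E.
Proof. by move=> r0; rewrite /below; case: ifP => // _; rewrite lee_fin. Qed.

Lemma below_le n r : 0 <= r -> (below n r <= r%:E)%E.
Proof. by move=> r0; rewrite /below; case: ifP => // _; rewrite lee_fin. Qed.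

(** A finite set F carries the sum up to e, and for n large every term indexed
    by F exceeds 1 / (n + 1); the terms retained are then outside F. *)
Lemma esum_below I a (e : R) : 0 < e -> (forall i, I i -> 0 < a i) ->
  (\esum_(i in I) (a i)%:E < +oo)%E ->
  exists n, (\esum_(i in I) below n (a i) <= e%:E)%E.
Proof.
move=> e0 a0 aoo.
have a0' i : I i -> (0 <= (a i)%:E)%E by move=> /a0/ltW; rewrite lee_fin.
have [F [finF FI FS]] := esum_adherent e0 a0' aoo.
have [n nF] : exists n, forall i, F i -> n.+1%:R^-1 <= a i.
  have /choice[k kP] i : exists n, F i -> n.+1%:R^-1 <= a i.
    have [Fi|nF] := pselect (F i); last by exists 0%N.
    by have [n ?] := invS_small (a0 i (FI i Fi)); exists n.
  have /finite_seqP[s sF] := finF.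
  exists (\max_(i <- s) k i) => i Fi; apply: le_trans (kP i Fi).
  rewrite lef_pV2 ?posrE// ler_nat ltnS.
  by apply: (leq_bigmax_seq (F := k) i) => //; move: Fi; rewrite sF.
exists n.
have FE : (\esum_(i in F) (a i)%:E = \esum_(i in I) (if i \in F then (a i)%:E else 0))%E.
  by rewrite -esum_mkcondr (setIidr FI).
have WF : (\esum_(i in I) below n (a i) + \esum_(i in F) (a i)%:E <=
    \esum_(i in I) (a i)%:E)%E.
  rewrite FE -esumD.
  - apply: le_esum => i Ii; case: ifP => [/set_mem Fi|_].
      by rewrite /below ltNge nF//= add0e.
    by rewrite adde0 below_le// ltW// a0.
  - by move=> i /a0/ltW; exact: below_ge0.
  - by move=> i Ii; case: ifP => // _; exact: a0'.
have Ffin : (\esum_(i in F) (a i)%:E)%E \is a fin_num.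
  rewrite ge0_fin_numE; first exact: le_lt_trans (subset_esum _ FI) aoo.
  by apply: esum_ge0 => i /FI/a0'.
by have := le_trans WF FS; rewrite addeC leeD2lE.
Qed.

End EsumTail.

(** * Sums over back orbits *)

Section FiberSum.
Context {R : realType} {d : measure_display} {X : measurableType d}.
Variables (mu : probability X R) (f : X -> X).
Hypothesis hX : standard_borel R X.
Hypothesis mf : measurable_fun setT f.
Hypothesis mcp : measure_class_preserving mu (orbit_rel f).

Variable D : nat -> set X.
Hypothesis mD : forall n, measurable (D n).
Hypothesis sepD : forall x y, (forall n, D n x <-> D n y) -> x = y.

(** The n-th code records membership in the first n separating sets; its
    fibers form finite partitions that refine one another and eventually
    separate any finite set of points. *)
Definition code n (y : X) : n.-tuple bool := [tuple `[< D i y >] | i < n].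

Lemma measurable_code n (b : n.-tuple bool) : measurable [set y | code n y = b].
Proof.
have -> : [set y | code n y = b] =
    \bigcap_(i in [set: 'I_n]) (if tnth b i then D i else ~` D i).
  apply/seteqP; split=> [y /= <- i _|y yb].
    by rewrite tnth_mktuple; case: asboolP.
  apply: eq_from_tnth => i; rewrite tnth_mktuple.
  by move: (yb i I); case: (tnth b i) => Dy; [exact: asboolT|exact: asboolF].
apply: (@fin_bigcap_measurable _ X _ [set: 'I_n]) => [|i _]; first exact: finite_finset.
by case: ifP => // _; exact: measurableC.
Qed.

Lemma code_injective (s : seq X) : exists n, {in s &, injective (code n)}.
Proof.
have /choice[k kP] (p : X * X) : exists n, p.1 <> p.2 -> ~ (D n p.1 <-> D n p.2).
  apply: contrapT => /forallNP H; have := H 0%N; apply => ne _.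
  apply: ne; apply: sepD => n; apply: contrapT => nD; apply: (H n) => _; exact: nD.
pose m := \max_(y <- s) \max_(z <- s) k (y, z).
exists m.+1 => y z ys zs e; apply: contrapT => ne.
have km : (k (y, z) < m.+1)%N.
  rewrite ltnS.
  apply: leq_trans (leq_bigmax_seq (F := fun y => \max_(z <- s) k (y, z)) y ys isT).
  exact: (leq_bigmax_seq (F := fun z => k (y, z)) z zs isT).
apply: (kP (y, z) ne) => /=.
have := congr1 (fun t => tnth t (Ordinal km)) e; rewrite !tnth_mktuple /=.
by move=> e'; split=> /asboolP H; apply/asboolP; [rewrite -e'|rewrite e'].
Qed.

Variable w : X * X -> \bar R.
Hypothesis mw : measurable_fun [set z : X * X | orbit_rel f z.1 z.2] w.
Hypothesis w0 : forall x y, orbit_rel f x y -> (0 <= w (x, y))%E.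

Let back_ge0 x y : back_orbit f x y -> (0 <= w (y, x))%E.
Proof. by move=> xy; apply: w0; apply: orbit_rel_sym; exact: orbit_rel_back. Qed.

Let cellsup n (b : n.-tuple bool) (x : X) : \bar R :=
  ereal_sup (0%E |` [set w (y, x) | y in back_orbit f x `&` [set y | code n y = b]]).

Let cellsup_ge0 n b x : (0 <= @cellsup n b x)%E.
Proof. by apply: ereal_sup_ubound; left. Qed.

Let cellsup_ge n y x : back_orbit f x y -> (w (y, x) <= cellsup (code n y) x)%E.
Proof. by move=> xy; apply: ereal_sup_ubound; right; exists y. Qed.

Let cellsup_le n b x : (@cellsup n b x <=
  \esum_(y in back_orbit f x) (if y \in [set y | code n y = b] then w (y, x) else 0))%E.
Proof.
apply: ge_ereal_sup => _ [->|[y [xy yb] <-]].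
  by apply: esum_ge0 => y xy; case: ifP => // _; exact: back_ge0.
apply: esum_ge; exists [set y].
  by split; [exact: finite_set1|move=> z ->].
by rewrite fsbig_set1 mem_set.
Qed.

Let approx n (x : X) : \bar R := (\sum_(b : n.-tuple bool) cellsup b x)%E.

(** The stage-n approximation adds up, over the cells of the n-th partition,
    the largest value of w in the cell. It never exceeds the sum, and it exceeds
    the sum over a finite set as soon as the partition separates its points. *)
Lemma fiber_sum_sup x :
  (\esum_(y in back_orbit f x) w (y, x))%E = ereal_sup (range (approx ^~ x)).
Proof.
apply/eqP; rewrite eq_le; apply/andP; split.
- apply: ge_ereal_sup => _ [F [finF Fx] <-].
  rewrite fsbig_finite//=; set s := finmap.enum_fset _.
  have sF y : y \in s -> back_orbit f x y.
    by move=> ys; apply: Fx; apply/set_mem; rewrite -in_fset_set.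
  have us : uniq s by exact: finmap.fset_uniq.
  have [n ninj] := code_injective s.
  apply: (@le_trans _ _ (approx n x)); last by apply: ereal_sup_ubound; exists n.
  apply: (@le_trans _ _ (\sum_(y <- s) cellsup (code n y) x)%E).
    rewrite big_seq [leRHS]big_seq; apply: lee_sum => y /sF; exact: cellsup_ge.
  rewrite -(big_map (code n) xpredT (fun b => cellsup b x)).
  have um : uniq [seq code n y | y <- s] by rewrite map_inj_in_uniq.
  rewrite (big_uniq _ um)/= /approx [leRHS](bigID (mem [seq code n y | y <- s]))/=.
  by rewrite leeDl// sume_ge0.
- apply: ge_ereal_sup => _ [n _ <-].
  apply: (@le_trans _ _ (\sum_(b : n.-tuple bool) \esum_(y in back_orbit f x)
      (if y \in [set y | code n y = b] then w (y, x) else 0))%E).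
    by apply: lee_sum => b _; exact: cellsup_le.
  rewrite -esum_sum; last first.
    by move=> y b xy _; case: ifP => // _; exact: back_ge0.
  apply: le_esum => y xy; rewrite (bigD1 (code n y))//= mem_set// big1 ?adde0// => b.
  by move=> /eqP nb; rewrite memNset// => e; apply: nb.
Qed.

(** The supremum of w over a cell is greater than q at x exactly when x is the
    image, under some iterate of f, of a point of the cell with value greater
    than q: a countable union of images of Borel sets, each measurable off a
    null set. *)
Lemma measurable_fiber_sum : exists2 N, invariant_null mu f N &
  measurable_fun (~` N) (fun x => \esum_(y in back_orbit f x) w (y, x))%E.
Proof.
pose slice (q : rat) m n (b : n.-tuple bool) : set X :=
  [set y | code n y = b] `&` [set y | ((ratr q)%:E < w (y, iter m f y))%E].
have mslice q m n b : measurable (@slice q m n b).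
  apply: measurableI; first exact: measurable_code.
  rewrite -[X in measurable X]setTI; apply: emeasurable_fun_o_infty => //.
  exact: (measurable_along_orbit hX mf).
have [N iN NP] : exists2 N, invariant_null mu f N &
    forall t : rat * nat * {n & n.-tuple bool},
      measurable (iter t.1.2 f @` slice t.1.1 t.1.2 (tag t.2) (tagged t.2) `\` N).
  apply: (@invariant_null_choice _ _ _ mu f _ (fun t N => measurable
     (iter t.1.2 f @` slice t.1.1 t.1.2 (tag t.2) (tagged t.2) `\` N))) => [t|t N N' _ [mN' _ _] NN'].
    exact: (image_iter_measurable hX mf mcp).
  exact: measurable_setDS.
exists N => //.
have mCN : measurable (~` N) by case: iN => mN _ _; exact: measurableC.
have mcell n b : measurable_fun (~` N) (@cellsup n b).
  apply: measurable_fun_rat_rays => // q.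
  have [q0|q0] := ltP q 0.
    rewrite (_ : _ `&` _ = ~` N)//; apply/setIidPl => x _ /=.
    by apply: lt_le_trans (cellsup_ge0 b x); rewrite lte_fin ltrq0.
  have -> : ~` N `&` [set x | ((ratr q)%:E < cellsup b x)%E] =
      \bigcup_m (iter m f @` slice q m n b `\` N).
    apply/seteqP; split=> [x [nN /=]|x [m _ [[y [yb qy] yx] nN]]].
      rewrite ltNge => /negP H; apply: contrapT => nU; apply: H.
      apply: ge_ereal_sup => _ [->|[y [[m yx] yb] <-]].
        by rewrite lee_fin ler0q.
      rewrite leNgt; apply/negP => qw; apply: nU; exists m => //; split=> //.
      by exists y => //; split=> //=; rewrite yx.
    split=> //=; apply: lt_le_trans qy _; rewrite yx.
    by rewrite -yb; apply: cellsup_ge; exists m.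
  by apply: bigcupT_measurable => m; exact: (NP (q, m, existT _ n b)).
have mapp n : measurable_fun (~` N) (approx n).
  by apply: emeasurable_sum.
apply: (eq_measurable_fun (fun x => esups (approx ^~ x) 0)).
  move=> x _; rewrite fiber_sum_sup /esups /sdrop; congr ereal_sup.
  by apply/seteqP; split=> [_ [n _ <-]|_ [n _ <-]]; exists n.
exact: measurable_fun_esups.
Qed.

End FiberSum.

(** * Mass transport along an orbit *)

Section Transport.
Context {R : realType} {d : measure_display} {X : measurableType d}.
Variables (mu : probability X R) (f : X -> X) (rho : X * X -> R).
Hypothesis hX : standard_borel R X.
Hypothesis mf : measurable_fun setT f.
Hypothesis facyclic : acyclic f.
Hypothesis mcp : measure_class_preserving mu (orbit_rel f).
Hypothesis hrho : radon_nikodym_cocycle mu (orbit_rel f) rho.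

Lemma rho_gt0 x y : orbit_rel f x y -> 0 < rho (x, y).
Proof. by case: hrho => _ + _ _; apply. Qed.

Lemma rho_ge0 x y : orbit_rel f x y -> 0 <= rho (x, y).
Proof. by move=> /rho_gt0/ltW. Qed.

Lemma rho_back_gt0 x y : back_orbit f x y -> 0 < rho (y, x).
Proof. by move=> xy; apply: rho_gt0; apply: orbit_rel_sym; exact: orbit_rel_back. Qed.

Lemma measurable_fun_back_sum (w : X * X -> \bar R) :
  measurable_fun [set z : X * X | orbit_rel f z.1 z.2] w ->
  (forall x y, orbit_rel f x y -> (0 <= w (x, y))%E) ->
  exists2 N, invariant_null mu f N &
  measurable_fun (~` N) (fun x => \esum_(y in back_orbit f x) w (y, x))%E.
Proof.
have [D [mD sepD]] := separating_family hX.
exact: measurable_fiber_sum.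
Qed.

(** The defining property of the cocycle, applied to h restricted to the pairs
    whose second point lies on the forward orbit of the first. *)
Lemma mass_transport (h : X * X -> \bar R) :
  measurable_fun [set z : X * X | orbit_rel f z.1 z.2] h ->
  (forall x y, orbit_rel f x y -> (0 <= h (x, y))%E) ->
  (\int[mu]_x (\sum_(0 <= n <oo) h (x, iter n f x)) =
   \int[mu]_x (\esum_(y in back_orbit f x) (h (y, x) * (rho (y, x))%:E)))%E.
Proof.
move=> mh h0.
pose h' z : \bar R := if `[< back_orbit f z.2 z.1 >] then h z else 0%E.
have mE := measurable_orbit_rel hX mf.
have mB := measurable_back_orbit hX mf.
have [_ _ _ /(_ h')] := hrho.
have -> : (fun x => \esum_(y in [set y | orbit_rel f x y]) h' (x, y))%E =
    (fun x => \sum_(0 <= n <oo) h (x, iter n f x))%E.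
  apply: funext => x.
  have -> : (\esum_(y in [set y | orbit_rel f x y]) h' (x, y) =
     \esum_(y in [set y | orbit_rel f x y])
       if y \in [set iter n f x | n in [set: nat]] then h (x, y) else 0)%E.
    apply: eq_esum => y xy; rewrite /h'; congr (if _ then _ else _).
    apply/asboolP/idP => [[n e]|/set_mem[n _ e]]; last by exists n.
    by apply/mem_set; exists n.
  rewrite -esum_mkcondr.
  rewrite (_ : _ `&` _ = [set iter n f x | n in [set: nat]]); last first.
    by apply/setIidPr => _ [n _ <-]; exact: orbit_rel_iter.
  rewrite esum_image; last by move=> m n _ _; exact: acyclic_iter_inj.
  rewrite nneseries_esumT// => n; apply: h0; exact: orbit_rel_iter.
have -> : (fun x => \esum_(y in [set y | orbit_rel f x y])
      (h' (y, x) * (rho (y, x))%:E))%E =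
    (fun x => \esum_(y in back_orbit f x) (h (y, x) * (rho (y, x))%:E))%E.
  apply: funext => x.
  have -> : (\esum_(y in [set y | orbit_rel f x y]) (h' (y, x) * (rho (y, x))%:E) =
     \esum_(y in [set y | orbit_rel f x y])
       if y \in back_orbit f x then h (y, x) * (rho (y, x))%:E else 0)%E.
    apply: eq_esum => y xy; rewrite /h'.
    case: asboolP => /= xy'; first by rewrite mem_set.
    by rewrite memNset// mul0e.
  rewrite -esum_mkcondr.
  rewrite (_ : _ `&` _ = back_orbit f x)//.
  by apply/setIidPr => y; exact: orbit_rel_back.
apply.
- apply: measurable_fun_if => //.
  + apply: measurable_funTS; apply: (measurable_fun_bool true).
    rewrite setTI (_ : _ @^-1` _ = [set z | back_orbit f z.2 z.1])//.
    by apply/seteqP; split=> z /= /asboolP.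
  + apply: measurable_funS mh => //; exact: subIsetl.
- move=> x y xy; rewrite /h'; case: ifP => // _; exact: h0.
Qed.

Definition back_mass (x : X) : \bar R :=
  (\esum_(y in back_orbit f x) (rho (y, x))%:E)%E.

Lemma back_mass_ge0 x : (0 <= back_mass x)%E.
Proof.
by apply: esum_ge0 => y xy; rewrite lee_fin ltW// rho_back_gt0.
Qed.

Lemma measurable_rho :
  measurable_fun [set z : X * X | orbit_rel f z.1 z.2] (fun z => (rho z)%:E).
Proof. by apply/measurable_EFinP; case: hrho. Qed.

Lemma measurable_back_mass : exists2 N, invariant_null mu f N &
  measurable_fun (~` N) back_mass.
Proof.
apply: (measurable_fun_back_sum measurable_rho) => x y xy.
by rewrite lee_fin rho_ge0.
Qed.

(** The back orbit of x is contained in that of f^n x, and by the cocycle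
    identity changing the base point multiplies all weights by a constant. *)
Lemma back_mass_lty n x : (back_mass (iter n f x) < +oo)%E ->
  (back_mass x < +oo)%E.
Proof.
move=> moo; have [_ _ coc _] := hrho.
have xn := orbit_rel_iter f n x.
have c0 : 0 < rho (iter n f x, x) by apply: rho_gt0; exact: orbit_rel_sym.
have a0 y : back_orbit f (iter n f x) y -> (0 <= (rho (y, iter n f x))%:E)%E.
  by move=> yx; rewrite lee_fin ltW// rho_back_gt0.
apply: (@le_lt_trans _ _ ((rho (iter n f x, x))%:E * back_mass (iter n f x))%E).
  apply: le_trans (esum_scale_le (ltW c0) a0).
  rewrite /back_mass.
  have -> : (\esum_(y in back_orbit f x) (rho (y, x))%:E =
    \esum_(y in back_orbit f x) ((rho (iter n f x, x))%:E * (rho (y, iter n f x))%:E))%E.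
    apply: eq_esum => y yb; have xy := orbit_rel_back yb; rewrite -EFinM mulrC coc//.
    apply/orbit_relP; move: xy => /orbit_relP[p [q e]].
    exists p, (n + q)%N; rewrite iterD -e -!iterD addnC//.
  by apply: subset_esum => y; apply: back_orbit_trans; exists n.
by rewrite lte_mul_pinfty// lee_fin ltW.
Qed.

End Transport.

(** * Summable weights and one-ended return maps *)

Section OrbitSums.
Context {R : realType} {X : Type}.
Variables (f : X -> X) (Q : X -> R).
Hypothesis Q0 : forall x, 0 < Q x.

Definition orbit_sum (x : X) : \bar R := (\sum_(0 <= n <oo) (Q (iter n f x))%:E)%E.

Let Qge0 x : (0 <= (Q x)%:E)%E.
Proof. by rewrite lee_fin ltW. Qed.

Lemma orbit_sum_ge0 x : (0 <= orbit_sum x)%E.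
Proof. by apply: nneseries_ge0 => n _ _; exact: Qge0. Qed.

Lemma orbit_sum_iter n x :
  orbit_sum (iter n f x) = (\sum_(n <= k <oo) (Q (iter k f x))%:E)%E.
Proof.
rewrite -(nneseries_addn (f := fun k => (Q (iter k f x))%:E))//.
by apply: eq_eseriesr => k _; rewrite iterD.
Qed.

Lemma orbit_sum_step x : orbit_sum x = ((Q x)%:E + orbit_sum (f x))%E.
Proof.
rewrite {1}/orbit_sum nneseries_recl//; congr (_ + _)%E.
exact/esym/(orbit_sum_iter 1).
Qed.

Lemma orbit_sum_le n x : (orbit_sum (iter n f x) <= orbit_sum x)%E.
Proof.
elim: n => [//|n IH]; apply: le_trans IH.
by rewrite [leRHS]orbit_sum_step leeDr.
Qed.

(** The sums along the forward orbit are the tails of a convergent series. *)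
Lemma orbit_sum_small x (e : R) : (orbit_sum x < +oo)%E -> 0 < e ->
  exists n, (orbit_sum (iter n f x) <= e%:E)%E.
Proof.
move=> xoo e0; have := nneseries_tail_cvg xoo (fun n _ => Qge0 (iter n f x)).
move=> cv; have : \forall n \near \oo, (\sum_(n <= k <oo) (Q (iter k f x))%:E < e%:E)%E.
  apply: (cv [set y | (y < e%:E)%E]); apply: open_nbhs_nbhs; split=> /=.
    exact: open_ereal_lt_ereal.
  by rewrite lte_fin.
by move=> [n _ /(_ n (leqnn _)) /ltW ?]; exists n; rewrite orbit_sum_iter.
Qed.

End OrbitSums.

Section Implications.
Context {R : realType} {d : measure_display} {X : measurableType d}.
Variables (mu : probability X R) (f : X -> X) (rho : X * X -> R).
Hypothesis hX : standard_borel R X.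
Hypothesis mf : measurable_fun setT f.
Hypothesis facyclic : acyclic f.
Hypothesis mcp : measure_class_preserving mu (orbit_rel f).
Hypothesis hrho : radon_nikodym_cocycle mu (orbit_rel f) rho.

Lemma measurable_orbit_sum (Q : X -> R) : measurable_fun setT Q ->
  (forall x, 0 < Q x) -> measurable_fun setT (orbit_sum f Q).
Proof.
move=> mQ Q0.
apply: (eq_measurable_fun (fun x => \sum_(0 <= n <oo | n \in xpredT) (Q (iter n f x))%:E)%E).
  by move=> x _.
apply: ge0_emeasurable_sum => [n x _ _|n _]; first by rewrite lee_fin ltW.
apply/measurable_EFinP; exact: (measurableT_comp mQ (measurable_iter mf n)).
Qed.

(** With R the mass of the back orbit, take Q = exp(- R). Transporting
    h(x,y) = Q(y) shows that the integral of the sums of Q along forward orbits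
    is at most the integral of R exp(- R), and t exp(- t) <= 1. *)
Lemma back_finite_summable :
  {ae mu, forall x, rho_finite rho x (back_orbit f x)} ->
  exists Q : X -> R, [/\ measurable_fun setT Q, forall x, 0 < Q x &
    {ae mu, forall x, (\sum_(0 <= n <oo) (Q (iter n f x))%:E < +oo)%E}].
Proof.
move=> /(ae_invariant_null mcp) h1.
have [|||N iN [moo mm]] := @invariant_null2 _ _ _ mu f
    (fun N => forall x, ~ N x -> rho_finite rho x (back_orbit f x))
    (fun N => measurable_fun (~` N) (back_mass f rho)) h1.
- exact: measurable_back_mass.
- by move=> N N' _ _ NN' H x nx; apply: H => /NN'.
- by move=> N N' [mN _ _] _ NN'; exact: measurable_funCS.
have [mN N0 _] := iN.
pose b x := `[< N x >].
have mb : measurable_fun setT b.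
  apply: (measurable_fun_bool true).
  rewrite setTI (_ : _ @^-1` _ = N)//.
  by apply/seteqP; split=> z /= /asboolP.
pose Q x : R := if b x then 1 else expR (- fine (back_mass f rho x)).
have Q0 x : 0 < Q x by rewrite /Q; case: ifP => // _; exact: expR_gt0.
have bF : setT `&` b @^-1` [set false] = ~` N.
  rewrite setTI; apply/seteqP; split=> [x /= /asboolPn//|x /= nN]; exact/asboolPn.
have mQ : measurable_fun setT Q.
  apply: measurable_fun_if => //.
  rewrite bF; apply: (measurableT_comp (@measurable_expR R)).
  apply: measurableT_comp => //; apply: measurableT_comp mm => //.
exists Q; split=> //.
apply: integral_lty_ae.
- exact: measurable_orbit_sum.
- by move=> x; exact: orbit_sum_ge0.
rewrite (mass_transport hX mf facyclic hrho (h := fun z => (Q z.2)%:E)).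
- apply: (@le_lt_trans _ _ 1%:E); last by rewrite ltry.
  apply: (integral_le_cst _ mN N0) => //.
    move=> x; apply: esum_ge0 => y xy; apply: mule_ge0; rewrite lee_fin ltW//.
    exact: (rho_back_gt0 hrho xy).
  move=> x nN; have xoo : (back_mass f rho x < +oo)%E := moo x nN.
  have m0 := back_mass_ge0 hrho x.
  apply: (@le_trans _ _ ((Q x)%:E * back_mass f rho x)%E).
    have a0 y : back_orbit f x y -> (0 <= (rho (y, x))%:E)%E.
      by move=> xy; rewrite lee_fin ltW//; exact: (rho_back_gt0 hrho xy).
    exact: (esum_scale_le (ltW (Q0 x)) a0).
  rewrite -[back_mass f rho x]fineK ?ge0_fin_numE// -EFinM lee_fin.
  rewrite /Q /b; case: asboolP => // _.
  rewrite expRN mulrC ler_pdivrMr ?expR_gt0// mul1r.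
  by apply: le_trans (expR_ge1Dx _); rewrite lerDr.
- apply: measurable_funTS; apply/measurable_EFinP.
  exact: measurableT_comp mQ (@measurable_snd _ _ X X).
- by move=> x y _; rewrite lee_fin ltW.
Qed.

(** Let G(x) be the sum of Q along the forward orbit of x, which decreases to
    0 along orbits. The set A_k of points with G <= 1 / (k + 1) and Q >= e_k is
    met by all forward orbits outside a set of measure 1 / (k + 1) once e_k is
    small; Y is the union of the A_k. Going backwards along a chain of Y, the
    value of G can only grow, so it stays above its initial value: only finitely
    many A_k are visited, hence Q is bounded below on the chain, and G, which
    increases by at least Q at each step, cannot remain at most 1 forever. *)
Lemma summable_return_one_ended (Q : X -> R) :
  measurable_fun setT Q -> (forall x, 0 < Q x) ->
  {ae mu, forall x, (orbit_sum f Q x < +oo)%E} ->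
  after_discarding_null mu (orbit_rel f) (fun X' : set X =>
    exists Y : set X, [/\ measurable Y,
      complete_section X' (connectedness X' f) Y,
      forward_recurrent f Y & one_ended Y (next_return f Y)]).
Proof.
move=> mQ Q0 /(ae_invariant_null mcp)[N0 iN0 Goo].
have [mN0 N00 _] := iN0.
pose G := orbit_sum f Q.
have mG : measurable_fun setT G by exact: measurable_orbit_sum.
pose A k j : set X := [set x | (G x <= (k.+1%:R^-1)%:E)%E /\ j.+1%:R^-1 <= Q x].
have mA k j : measurable (A k j).
  rewrite (_ : A k j = (setT `&` [set x | (G x <= (k.+1%:R^-1)%:E)%E]) `&`
     (setT `&` Q @^-1` `[j.+1%:R^-1, +oo[)).
    apply: measurableI; last exact: mQ.
    exact: emeasurable_fun_infty_c.
  rewrite !setTI; apply/seteqP; split=> x /= -[H1 H2]; split=> //.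
    by rewrite in_itv/= H2.
  by move: H2; rewrite in_itv/= andbT.
pose M k j := \bigcup_n (iter n f @^-1` A k j).
have mM k j : measurable (M k j).
  by apply: bigcupT_measurable => n; exact: measurable_preimage_iter.
have ndM k : nondecreasing_seq (M k).
  move=> i j ij; apply/subsetPset => x [n _ [H1 H2]]; exists n => //; split=> //.
  by apply: le_trans H2; rewrite lef_pV2 ?posrE// ler_nat ltnS.
have /choice[j jP] k : exists j, (mu (~` N0 `\` M k j) <= (k.+1%:R^-1)%:E)%E.
  apply: measure_exhaust => //; first exact: measurableC.
  move=> x nx.
  have [n Gn] := orbit_sum_small Q0 (Goo x nx) (e := k.+1%:R^-1) ltac:(by rewrite invr_gt0).
  have [i iQ] := invS_small (Q0 (iter n f x)).
  by exists i => //; exists n.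
pose miss := ~` N0 `\` \bigcup_k M k (j k).
have mmiss : measurable miss.
  by apply: measurableD; [exact: measurableC|exact: bigcupT_measurable].
have miss0 : mu miss = 0%E.
  apply: measure_le_eps0 => // e /invS_small[k ke].
  apply: (@le_trans _ _ (mu (~` N0 `\` M k (j k)))).
    apply: le_measure; [exact: mem_set|apply: mem_set|].
      by apply: measurableD => //; exact: measurableC.
    by move=> x [nx nM]; split=> // Mx; apply: nM; exists k.
  by apply: le_trans (jP k) _; rewrite lee_fin.
have [N iN NN] : exists2 N, invariant_null mu f N & N0 `|` miss `<=` N.
  apply: invariant_null_hull => //.
  by apply: negligibleU; apply/negligibleP.
have [mN mu0 invN] := iN.
pose Y := \bigcup_k A k (j k) `\` N.
have hit x : ~ N x -> exists n, Y (iter n f x).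
  move=> nN; have : (\bigcup_k M k (j k)) x.
    apply: contrapT => nM; apply: (nN); apply: (NN); right; split=> // Nx.
    by apply: nN; apply: NN; left.
  move=> [k _ [n _ Ak]]; exists n; split; first by exists k.
  exact: invariant_nullC_iter iN nN.
have rec : forward_recurrent f Y.
  move=> y [_ nN]; have [n Yn] := hit (f y) (invariant_nullC_iter (n := 1) iN nN).
  by exists n.+1 => //; rewrite iterSr.
exists N; split=> //; exists Y; split=> //.
- by apply: measurableD => //; exact: bigcupT_measurable.
- split; first by move=> x [].
  move=> x nN; have [n Yn] := hit x nN; exists (iter n f x) => //.
  apply/connectednessP => //; first by move=> z; exact: (invariant_nullC_iter (n := 1) iN).
  by split; [exact: invariant_nullC_iter iN nN|exists n, 0%N].
apply/one_ended_returnP => // -[r [Yr rS]].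
have /choice[k kP] n : exists k, A k (j k) (r n) by have [[k _ Ak] _] := Yr n; exists k.
have nN n : ~ N0 (r n) by move=> N0r; have [_] := Yr n; apply; apply: NN; left.
have Gfin x : ~ N0 x -> G x \is a fin_num.
  by move=> nx; rewrite ge0_fin_numE; [exact: Goo|exact: orbit_sum_ge0].
have Gstep n : ((Q (r n.+1))%:E + G (r n) <= G (r n.+1))%E.
  have [m [m0 em _ _]] := next_returnP rec (Yr n.+1).
  have <- : iter m.-1 f (f (r n.+1)) = r n by rewrite -iterSr prednK// -em rS.
  by rewrite /G [leRHS]orbit_sum_step// leeD2l// orbit_sum_le.
have G0 n : (G (r 0%N) <= G (r n))%E.
  elim: n => [//|n IH]; apply: le_trans IH _; apply: le_trans (Gstep n).
  by rewrite leeDr// lee_fin ltW.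
have g0 : 0 < fine (G (r 0%N)).
  rewrite fine_gt0//; apply/andP; split; last exact: Goo.
  rewrite /G orbit_sum_step//; apply: (@lt_le_trans _ _ (Q (r 0%N))%:E).
    by rewrite lte_fin.
  by rewrite leeDl// orbit_sum_ge0.
have [K KG] := invS_small (e := fine (G (r 0%N)) / 2) ltac:(by rewrite divr_gt0).
have kK n : (k n <= K)%N.
  rewrite leqNgt; apply/negP => Kk.
  have [Gk _] := kP n; have := le_trans (G0 n) Gk.
  rewrite -[G (r 0%N)]fineK ?Gfin// lee_fin => g1.
  have : fine (G (r 0%N)) <= fine (G (r 0%N)) / 2.
    apply: le_trans g1 _; apply: le_trans KG; rewrite lef_pV2 ?posrE// ler_nat.
    by rewrite ltnS ltnW.
  by apply/negP; rewrite -ltNge ltr_pdivrMr// ltr_pMr// ltr1n.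
pose J := \max_(i < K.+1) j i.
have QJ n : J.+1%:R^-1 <= Q (r n).
  have [_ Qk] := kP n; apply: le_trans Qk; rewrite lef_pV2 ?posrE// ler_nat ltnS.
  by apply: (leq_bigmax (F := fun i : 'I_K.+1 => j i) (Ordinal (kK n : (k n < K.+1)%N))).
have Gn n : ((n%:R * J.+1%:R^-1)%:E <= G (r n))%E.
  elim: n => [|n IH]; first by rewrite mul0r; exact: orbit_sum_ge0.
  apply: le_trans (Gstep n); rewrite -natr1 mulrDl mul1r addrC EFinD.
  by apply: leeD => //; rewrite lee_fin.
have [Gk _] := kP J.+2; have := le_trans (Gn J.+2) Gk.
rewrite lee_fin => H; have : (J.+2%:R / J.+1%:R : R) <= 1.
  by apply: le_trans H _; rewrite invf_le1// ler1n.
by rewrite ler_pdivrMr// mul1r ler_nat ltnn.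
Qed.


(** Let B be the set of points of Y with infinite back mass. The points of B
    with no proper ancestor in B form an antichain B0 for the forward orbits, so
    transporting the indicator of B0 bounds (+oo) mu(B0) by 1: B0 is null. Off a
    null set every point of B thus has an ancestor in B, hence a preimage in B
    under the return map (the back mass is infinite at every forward iterate of
    such an ancestor), and B is empty since there is no infinite backward
    path. *)
Lemma return_one_ended_back_finite :
  after_discarding_null mu (orbit_rel f) (fun X' : set X =>
    exists Y : set X, [/\ measurable Y,
      complete_section X' (connectedness X' f) Y,
      forward_recurrent f Y & one_ended Y (next_return f Y)]) ->
  {ae mu, forall x, rho_finite rho x (back_orbit f x)}.
Proof.
move=> [N [mN N0 invN [Y [mY [YN csY] rec oe]]]].
have iN : invariant_null mu f N by split.
have nobr : ~ exists r, backward_ray Y (next_return f Y) r.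
  exact/(one_ended_returnP facyclic rec).
have [N1 iN1 [NN1 mm]] : exists2 N1, invariant_null mu f N1 &
    N `<=` N1 /\ measurable_fun (~` N1) (back_mass f rho).
  apply: invariant_null2.
  - by exists N.
  - exact: measurable_back_mass.
  - by move=> A B _ _ AB NA; exact: subset_trans AB.
  - by move=> A B [mA _ _] _ AB; exact: measurable_funCS.
have mCN1 : measurable (~` N1) by case: iN1 => ? _ _; exact: measurableC.
pose B := Y `&` (~` N1 `&` back_mass f rho @^-1` [set +oo%E]).
have mB : measurable B by apply: measurableI => //; exact: mm.
have [N2 iN2 [N12 mI]] : exists2 N2, invariant_null mu f N2 &
    N1 `<=` N2 /\ forall n, measurable (iter n f @` B `\` N2).
  apply: invariant_null2.
  - by exists N1.
  - apply: (invariant_null_choice (Q := fun n N2 => measurable (iter n f @` B `\` N2))).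
      by move=> n; exact: image_iter_measurable.
    by move=> n A C _ [mC _ _] sAC; exact: measurable_setDS.
  - by move=> A C _ _ sAC NA; exact: subset_trans sAC.
  - by move=> A C _ [mC _ _] sAC mA n; exact: measurable_setDS (mA n).
have [mN2 N20 invN2] := iN2.
pose B0 := B `\` N2 `\` \bigcup_n (iter n.+1 f @` B `\` N2).
have mB0 : measurable B0.
  apply: measurableD; first exact: measurableD.
  by apply: bigcupT_measurable => n; exact: mI.
have antichain x m n : (m < n)%N -> B0 (iter m f x) -> ~ B0 (iter n f x).
  move=> mn [[Bm _] _] [[_ nN] nI]; apply: nI; exists (n - m).-1 => //; split=> //.
  by exists (iter m f x) => //; rewrite -iterD; congr (iter _ f x); lia.
have B00 : mu B0 = 0%E.
  pose h (z : X * X) : \bar R := (\1_B0 z.2 : R)%:E.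
  have MT := mass_transport hX mf facyclic hrho (h := h).
  have h0 z : (0 <= h z)%E by rewrite lee_fin.
  have lhs : (\int[mu]_x (\sum_(0 <= n <oo) h (x, iter n f x)) <= 1%:E)%E.
    apply: (integral_le_cst _ measurable0) => //.
      by move=> x; apply: nneseries_ge0.
    move=> x _; rewrite nneseries_esumT//.
    have [[m Bm]|nB] := pselect (exists m, B0 (iter m f x)); last first.
      rewrite esum1 ?lee_fin// => n _; rewrite /h/= indicE memNset// => Bn.
      by apply: nB; exists n.
    rewrite (esumID [set m])// setTI esum_set1// [X in (_ + X)%E]esum1 ?adde0; last first.
      move=> n [_ /= nm]; rewrite /h/= indicE memNset// => Bn.
      have [mn|nm'|e] := ltngtP m n.
      - exact: antichain mn Bm Bn.
      - exact: antichain nm' Bn Bm.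
      - by apply: nm.
    by rewrite /h/= indicE mem_set.
  have rhs : (\int[mu]_(x in B0) (cst +oo x) <= 1%:E :> \bar R)%E.
    apply: le_trans lhs; rewrite MT//; last first.
      apply: measurable_funTS; apply/measurable_EFinP.
      apply: measurableT_comp (@measurable_snd _ _ X X).
      exact: measurable_indic.
    rewrite integral_mkcond; apply: ge0_le_integralT => x.
      by rewrite /patch; case: ifP => _ /=; [exact: leey|exact: lexx].
    rewrite /patch; case: ifP => [/set_mem Bx|_]; last first.
      apply: esum_ge0 => y xy; apply: mule_ge0 => //; rewrite lee_fin ltW//.
      exact: (rho_back_gt0 hrho xy).
    have [[[_ [_ xoo]] _] _] := Bx.
    have -> : (\esum_(y in back_orbit f x) (h (y, x) * (rho (y, x))%:E) =
        back_mass f rho x)%E.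
      by apply: eq_esum => y _; rewrite /h/= indicE mem_set// mul1e.
    by rewrite xoo.
  rewrite integral_cst// in rhs.
  apply/eqP; rewrite eq_le measure_ge0 andbT leNgt; apply/negP => B0gt.
  by move: rhs; rewrite gt0_mulye.
have [N3 iN3 N23] : exists2 N3, invariant_null mu f N3 & N2 `|` B0 `<=` N3.
  apply: invariant_null_hull => //.
  by apply: negligibleU; apply/negligibleP.
have fin_on_Y y : Y y -> ~ N3 y -> (back_mass f rho y < +oo)%E.
  move=> Yy nN3; rewrite ltey; apply/eqP => yoo; apply: nobr.
  have nN1 z : ~ N3 z -> ~ N1 z by move=> nz N1z; apply: nz; apply: (N23); left; exact: N12.
  have [|b [Bb nb]|r [_ Pr rS]] := @dependent_choice_nat X
      (fun b => B b /\ ~ N3 b) (fun b c => next_return f Y c = b) y.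
  - by split=> //; split=> //; split=> //; exact: nN1.
  - have [n [a Ba ab]] : exists n, (iter n.+1 f @` B) b.
      apply: contrapT => nI; apply: (nb); apply: (N23); right; split.
        by split=> // N2b; apply: (nb); apply: (N23); left.
      by move=> [n _ [Ib _]]; apply: nI; exists n.
    have [c cb [j Yc ce]] := return_preimage rec Ba.1 Bb.1 (ltn0Sn n) ab.
    exists c => //.
    have na : ~ N3 a.
      by move=> Na; apply: nb; rewrite -ab; case: iN3 => _ _; apply; [exact: orbit_rel_iter|].
    have nc : ~ N3 c by rewrite ce; exact: invariant_nullC_iter iN3 na.
    split=> //; split=> //; split; first exact: nN1.
    rewrite /preimage/=; apply/eqP; rewrite -leye_eq leNgt ce; apply/negP.
    by move=> /(back_mass_lty hrho); have [_ [_ ->]] := Ba; rewrite ltxx.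
  - by exists r; split=> // n; have [[]] := Pr n.
have [mN3 N30 _] := iN3.
apply: (ae_of_null mN3 N30) => x nN3.
have nN : ~ N x by move=> Nx; apply: nN3; apply: N23; left; apply: N12; exact: NN1.
have [y Yy] := csY x nN.
move=> /connectednessP[|//|_ [m [n e]]].
  by move=> z; exact: (invariant_nullC_iter (n := 1) iN).
have [k [nk ek]] := iter_next_return n rec Yy.
have Yk : Y (iter k f y).
  by rewrite -ek; apply: iter_stable Yy => z; exact: next_return_stable.
have ekx : iter k f y = iter (k - n + m) f x.
  by rewrite iterD e -iterD subnK.
apply: (back_mass_lty hrho (n := k - n + m)).
rewrite -ekx; apply: fin_on_Y => //; rewrite ekx.
exact: invariant_nullC_iter iN3 nN3.
Qed.

End Implications.

(** * Sparse sections and one-ended invariant sets *)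

Section SparseSections.
Context {R : realType} {d : measure_display} {X : measurableType d}.
Variables (mu : probability X R) (f : X -> X) (rho : X * X -> R).
Hypothesis hX : standard_borel R X.
Hypothesis mf : measurable_fun setT f.
Hypothesis facyclic : acyclic f.
Hypothesis mcp : measure_class_preserving mu (orbit_rel f).
Hypothesis hrho : radon_nikodym_cocycle mu (orbit_rel f) rho.

Let E := [set z : X * X | orbit_rel f z.1 z.2].

Let mE : measurable E.
Proof. exact: (measurable_orbit_rel hX mf). Qed.

Let mrho : measurable_fun E rho.
Proof. by case: hrho. Qed.

Let light n : set (X * X) := E `&` rho @^-1` `]-oo, n.+1%:R^-1[.

Let mlight n : measurable (light n).
Proof. exact: mrho. Qed.

Let tail n x := (\esum_(y in back_orbit f x) below n (rho (y, x)))%E.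

Let measurable_tail n : exists2 N, invariant_null mu f N &
  measurable_fun (~` N) (tail n).
Proof.
apply: (measurable_fun_back_sum hX mf mcp (w := fun z => below n (rho z))).
  apply: measurable_fun_if => //.
  - by apply: measurable_fun_ltr => //; exact: measurable_cst.
  - apply: (@measurable_funS _ _ _ _ E) => //; exact/measurable_EFinP.
by move=> x y xy; apply: below_ge0; exact: (rho_ge0 hrho xy).
Qed.

(** Call y light at a forward iterate x of y when its weight at x is less than
    a threshold c(x) = 1 / (n + 1), with n least such that the weights less than
    1 / (n + 1) in the back orbit of x add up to at most e. By mass transport the
    points that are light at some forward iterate have measure at most e. The
    set A of the others has finitely many points in each back orbit, since their
    weights at x are bounded below by c(x) and add up to a finite sum. *)
Lemma sparse_sections :
  {ae mu, forall x, rho_finite rho x (back_orbit f x)} ->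
  exists2 N, invariant_null mu f N & forall e : R, 0 < e -> exists A : set X,
    [/\ measurable A, A `<=` ~` N, (mu (~` N `\` A) <= e%:E)%E &
      forall x, ~ N x -> finite_set (back_orbit f x `&` A)].
Proof.
move=> /(ae_invariant_null mcp) h1.
have [|||N iN [moo mm]] := @invariant_null2 _ _ _ mu f
    (fun N => forall x, ~ N x -> rho_finite rho x (back_orbit f x))
    (fun N => forall n, measurable_fun (~` N) (tail n)) h1.
- apply: (invariant_null_choice (Q := fun n N => measurable_fun (~` N) (tail n))).
    exact: measurable_tail.
  by move=> n N N' [mN _ _] _ NN'; exact: measurable_funCS.
- by move=> N N' _ _ NN' H x nx; apply: H => /NN'.
- by move=> N N' [mN _ _] _ NN' H n; exact: measurable_funCS (H n).
exists N => // e e0; have [mN N0 invN] := iN.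
have mCN : measurable (~` N) by exact: measurableC.
pose C n := ~` N `&` [set x | (tail n x <= e%:E)%E].
have mC n : measurable (C n) by exact: emeasurable_fun_infty_c.
(* on D n, the least index at which the tail is at most e is n *)
pose D := seqDU C.
have mD n : measurable (D n).
  by apply: measurableD => //; apply: bigsetU_measurable.
have DU x : ~ N x -> exists n, D n x.
  move=> nN.
  have [n ne] : exists n, (tail n x <= e%:E)%E.
    apply: esum_below => //; last exact: moo.
    by move=> y xy; exact: (rho_back_gt0 hrho xy).
  have : (\bigcup_n C n) x by exists n.
  by rewrite seqDU_bigcup_eq => -[k _ Dk]; exists k.
have DC n x : D n x -> C n x by move=> [].
have Duniq m n x : D m x -> D n x -> m = n.
  by move=> Dm Dn; apply: (@trivIset_seqDU _ C m n I I); exists x.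
pose L : set (X * X) := \bigcup_n (snd @^-1` D n `&` light n).
have mL : measurable L.
  apply: bigcupT_measurable => n; apply: measurableI => //.
  by rewrite -[X in measurable X]setTI; exact: measurable_snd.
pose A := ~` N `&` \bigcap_m [set y | ~ L (y, iter m f y)].
have mA : measurable A.
  apply: measurableI => //; apply: bigcapT_measurable => m.
  apply: measurableC.
  have mg : measurable_fun setT (fun y => (y, iter m f y)).
    by apply: measurable_fun_pair => //; exact: measurable_iter.
  by have := mg measurableT _ mL; rewrite setTI.
exists A; split=> //.
- by move=> x [].
- pose h z : \bar R := (\1_L z : R)%:E.
  have h0 z : (0 <= h z)%E by rewrite lee_fin.
  have MT := mass_transport hX mf facyclic hrho (h := h).
  have rhs : (\int[mu]_x (\esum_(y in back_orbit f x) (h (y, x) * (rho (y, x))%:E))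
      <= e%:E)%E.
    apply: (integral_le_cst _ mN N0) => //; last 2 first.
    + exact: ltW.
    + move=> x nN; have [n Dn] := DU x nN; have [_ /= Ln] := DC _ _ Dn.
      apply: le_trans Ln; apply: le_esum => y xy.
      have r0 := rho_back_gt0 hrho xy.
      have [yL|nL] := pselect (L (y, x)); last first.
        by rewrite /h indicE memNset// mul0e below_ge0// ltW.
      rewrite /h indicE mem_set// mul1e.
      have [m _ [Dm [_ /=]]] := yL; rewrite in_itv/= => rm.
      by rewrite /below -(Duniq _ _ _ Dm Dn) rm.
    + move=> x; apply: esum_ge0 => y xy; apply: mule_ge0 => //; rewrite lee_fin ltW//.
      exact: (rho_back_gt0 hrho xy).
  rewrite -MT// in rhs; last first.
    by apply: measurable_funTS; apply/measurable_EFinP; exact: measurable_indic.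
  apply: le_trans rhs.
  rewrite -[X in (mu X <= _)%E]setIT -integral_indic//; last exact: measurableD.
  apply: ge0_le_integralT => x; first by rewrite lee_fin.
  rewrite indicE; case: (boolP (x \in _)) => [/set_mem[nN nA]|_]; last exact: nneseries_ge0.
  have [m Lm] : exists m, L (x, iter m f x).
    apply: contrapT => nL; apply: nA; split=> // m _ Lm; apply: nL; by exists m.
  apply: le_trans (nneseries_lim_ge m.+1 _) => //.
  rewrite big_nat_recr//=; apply: le_trans (leeDr _ _); last exact: sume_ge0.
  by rewrite /h indicE mem_set.
- move=> x nN; have [n Dn] := DU x nN.
  have r0 : 0 < n.+1%:R^-1 :> R by rewrite invr_gt0.
  apply: sub_finite_set (esum_lty_finite (I := back_orbit f x)
     (a := fun y => (rho (y, x))%:E) r0 _ _).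
  + move=> y [xy [nNy nLy]]; split=> //; rewrite lee_fin leNgt; apply/negP => rn.
    have [m mx] := xy; apply: (nLy m I); rewrite mx; exists n => //; split=> //.
    split; last by rewrite /preimage/= in_itv.
    by apply: orbit_rel_sym; exact: orbit_rel_back.
  + by move=> y xy; rewrite lee_fin ltW//; exact: (rho_back_gt0 hrho xy).
  + exact: moo.
Qed.

(** The forward saturation Z_k of a set with finitely many points in each back
    orbit also has finitely many points in each back orbit: those between a
    point of A_k and x. The saturations W_k of the Z_k cover almost everything,
    and using Z_k only off the union of W_j, j < k, keeps back orbits finite
    while meeting every class. Finite back orbits leave no room for an infinite
    backward path. *)
Lemma back_finite_invariant_section :
  {ae mu, forall x, rho_finite rho x (back_orbit f x)} ->
  after_discarding_null mu (orbit_rel f) (fun X' : set X =>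
    exists Z : set X, [/\ measurable Z,
      complete_section X' (connectedness X' f) Z,
      forward_invariant f Z, one_ended Z f & finite_to_one_on Z f]).
Proof.
move=> /sparse_sections[N1 iN1 sparse].
have [mN1 N10 _] := iN1.
have /choice[A AP] k := sparse k.+1%:R^-1 ltac:(by rewrite invr_gt0).
have mA k : measurable (A k) by have [] := AP k.
pose miss := ~` N1 `\` \bigcup_k A k.
have mmiss : measurable miss.
  by apply: measurableD; [exact: measurableC|exact: bigcupT_measurable].
have miss0 : mu miss = 0%E.
  apply: measure_le_eps0 => // e /invS_small[k ke].
  apply: (@le_trans _ _ (mu (~` N1 `\` A k))).
    apply: le_measure; [exact: mem_set|apply: mem_set|].
      by apply: measurableD => //; exact: measurableC.
    by move=> x [nx nM]; split=> // Mx; apply: nM; exists k.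
  by have [_ _ Ak _] := AP k; apply: le_trans Ak _; rewrite lee_fin.
have [N iN [NN mI]] : exists2 N, invariant_null mu f N &
    N1 `|` miss `<=` N /\
    forall t : nat * nat, measurable (iter t.1 f @` A t.2 `\` N).
  apply: invariant_null2.
  - apply: invariant_null_hull => //.
    by apply: negligibleU; apply/negligibleP.
  - apply: (invariant_null_choice (Q := fun t N => measurable (iter t.1 f @` A t.2 `\` N))).
      by move=> t; exact: image_iter_measurable.
    by move=> t B C _ [mC _ _] sBC; exact: measurable_setDS.
  - by move=> B C _ _ sBC NB; exact: subset_trans sBC.
  - by move=> B C _ [mC _ _] sBC mB t; exact: measurable_setDS (mB t).
have [mN N0 invN] := iN.
pose Z k := \bigcup_n (iter n f @` A k `\` N).
have mZ k : measurable (Z k).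
  by apply: bigcupT_measurable => n; exact: (mI (n, k)).
have ZN k x : Z k x -> ~ N x by move=> [n _ []].
have Zf k n x : Z k x -> Z k (iter n f x).
  move=> [m _ [[a Aa <-] nN]]; exists (n + m)%N => //; split.
    by exists a => //; rewrite iterD.
  exact: invariant_nullC_iter iN nN.
pose W k := \bigcup_n (iter n f @^-1` Z k).
have mW k : measurable (W k).
  by apply: bigcupT_measurable => n; exact: measurable_preimage_iter.
have Wf k n x : W k (iter n f x) -> W k x.
  by move=> [m _ Zm]; exists (m + n)%N => //; rewrite /preimage/= iterD.
have fW k n x : W k x -> W k (iter n f x).
  move=> [m _ Zm]; exists m => //; rewrite /preimage/= -iterD addnC iterD.
  exact: Zf.
have ZW k x : Z k x -> W k x by move=> Zx; exists 0%N.
pose V k := Z k `\` \big[setU/set0]_(j < k) W j.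
have VP k x : V k x <-> Z k x /\ forall j, (j < k)%N -> ~ W j x.
  rewrite /V -bigcup_mkord; split=> [[Zx nW]|[Zx nW]]; split=> //.
    by move=> j jk Wj; apply: nW; exists j.
  by move=> [j /= jk Wj]; exact: nW jk Wj.
pose S := \bigcup_k V k.
have SN x : S x -> ~ N x by move=> [k _ /VP[Zx _]]; exact: ZN Zx.
have Sf : forall x, S x -> S (f x).
  move=> x [k _ /VP[Zx nW]]; exists k => //; apply/VP; split.
    exact: (Zf k 1%N).
  by move=> j jk Wj; apply: (nW j jk); exact: (Wf j 1%N).
have fin_back x : S x -> finite_set (back_orbit f x `&` S).
  move=> [k _ /VP[Zx nW]].
  have [_ AN _ /(_ x) finA] := AP k.
  have {}finA : finite_set (back_orbit f x `&` A k).
    by apply: finA => N1x; apply: (ZN _ _ Zx); apply: NN; left.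
  have /choice[l lP] a : exists n, back_orbit f x a -> iter n f a = x.
    have [[n na]|nb] := pselect (back_orbit f x a); first by exists n.
    by exists 0%N.
  apply: (@sub_finite_set _ _ (\bigcup_(a in back_orbit f x `&` A k)
     ((fun m => iter m f a) @` `I_(l a).+1))); last first.
    by apply: bigcup_finite => // a _; apply: finite_image; exact: finite_II.
  move=> y [[p px] [k' _ /VP[Zy nW']]].
  have kk' : k' = k.
    have [lt|lt|//] := ltngtP k' k.
    - exfalso; apply: (nW k' lt); rewrite -px; apply: fW; exact: ZW.
    - exfalso; apply: (nW' k lt); apply: (Wf k p); rewrite px; exact: ZW.
  move: Zy; rewrite kk' => -[m _ [[a Aa ay] _]].
  have xa : back_orbit f x a by exists (p + m)%N; rewrite iterD ay.
  exists a => //; exists m => //=.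
  have : iter (l a) f a = iter (p + m) f a by rewrite lP// iterD ay px.
  by move=> /(acyclic_iter_inj facyclic) ->; rewrite ltnS leq_addl.
exists N; split=> //; exists S; split.
- by apply: bigcupT_measurable => k; apply: measurableD => //; exact: bigsetU_measurable.
- split; first exact: SN.
  move=> x nN.
  have [k Ak] : exists k, A k x.
    apply: contrapT => nA; apply: (nN); apply: (NN); right; split.
      by move=> N1x; apply: (nN); apply: (NN); left.
    by move=> [k _ Ak]; apply: nA; exists k.
  have exW : exists k, `[< W k x >].
    by exists k; apply/asboolP; apply: ZW; exists 0%N => //; split=> //; exists x.
  case: (ex_minnP exW) => k0 /asboolP[n _ Zn] kmin.
  exists (iter n f x).
    exists k0 => //; apply/VP; split=> // j jk /Wf Wj.
    by have := kmin j (asboolT Wj); rewrite leqNgt jk.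
  apply/connectednessP => //; first by move=> z; exact: (invariant_nullC_iter (n := 1) iN).
  by split; [exact: invariant_nullC_iter iN nN|exists n, 0%N].
- by move=> _ [x Sx <-]; exact: Sf.
- have ac n x : S x -> (0 < n)%N -> iter n f x <> x by move=> _; exact: facyclic.
  apply/(one_endedP Sf ac) => -[r rr].
  apply: infinite_nat.
  have rinj := backward_ray_inj rr ac.
  have <- : r @^-1` (back_orbit f (r 0%N) `&` S) = setT; last first.
    apply: finite_preimage (fin_back _ (rr.1 0%N)).
    by move=> m n _ _; exact: rinj.
  apply/seteqP; split=> // n _; split; last exact: rr.1.
  by exists n; have := iter_backward_ray n 0 rr; rewrite addn0.
- move=> z Sz; apply: sub_finite_set (fin_back z Sz) => y [Sy yz]; split=> //.
  by exists 1%N.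
Qed.

End SparseSections.

(** * The equivalences *)

Section WeakenSections.
Context {R : realType} {d : measure_display} {X : measurableType d}.
Variables (mu : probability X R) (E : X -> X -> Prop) (f : X -> X).

Lemma finite_to_one_forget :
  after_discarding_null mu E (fun X' : set X =>
    exists Z : set X, [/\ measurable Z,
      complete_section X' (connectedness X' f) Z,
      forward_invariant f Z, one_ended Z f & finite_to_one_on Z f]) ->
  after_discarding_null mu E (fun X' : set X =>
    exists Z : set X, [/\ measurable Z,
      complete_section X' (connectedness X' f) Z,
      forward_invariant f Z & one_ended Z f]).
Proof.
by move=> [N [mN N0 iN [Z [mZ cZ fZ oZ _]]]]; exists N; split=> //; exists Z.
Qed.

Lemma invariant_section_return : acyclic f ->
  after_discarding_null mu E (fun X' : set X =>
    exists Z : set X, [/\ measurable Z,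
      complete_section X' (connectedness X' f) Z,
      forward_invariant f Z & one_ended Z f]) ->
  after_discarding_null mu E (fun X' : set X =>
    exists Y : set X, [/\ measurable Y,
      complete_section X' (connectedness X' f) Y,
      forward_recurrent f Y & one_ended Y (next_return f Y)]).
Proof.
move=> fa [N [mN N0 iN [Z [mZ cZ fZ oZ]]]]; exists N; split=> //; exists Z.
split=> //; first exact: forward_invariant_recurrent.
exact: one_ended_return_invariant.
Qed.

End WeakenSections.

Theorem theorem1p4 (R : realType) (d : measure_display) (X : measurableType d)
    (mu : probability X R) (f : X -> X) (rho : X * X -> R)
    (hX : standard_borel R X)
    (hf_borel : measurable_fun setT f)
    (hf_acyclic : acyclic f)
    (hf_countable : countable_to_one f)
    (hmcp : measure_class_preserving mu (orbit_rel f))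
    (hrho : radon_nikodym_cocycle mu (orbit_rel f) rho) :
  [<-> {ae mu, forall x, rho_finite rho x (back_orbit f x)};
       exists Q : X -> R,
         [/\ measurable_fun setT Q,
             forall x, 0 < Q x &
             {ae mu, forall x,
               (\sum_(0 <= n <oo) (Q (iter n f x))%:E < +oo)%E}];
       after_discarding_null mu (orbit_rel f) (fun X' : set X =>
         exists Y : set X,
           [/\ measurable Y,
               complete_section X' (connectedness X' f) Y,
               forward_recurrent f Y &
               one_ended Y (next_return f Y)]);
       after_discarding_null mu (orbit_rel f) (fun X' : set X =>
         exists Z : set X,
           [/\ measurable Z,
               complete_section X' (connectedness X' f) Z,
               forward_invariant f Z &
               one_ended Z f]);
       after_discarding_null mu (orbit_rel f) (fun X' : set X =>
         exists Z : set X,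
           [/\ measurable Z,
               complete_section X' (connectedness X' f) Z,
               forward_invariant f Z,
               one_ended Z f &
               finite_to_one_on Z f])].
Proof.
have h12 := back_finite_summable hX hf_borel hf_acyclic hmcp hrho.
have h31 := return_one_ended_back_finite hX hf_borel hf_acyclic hmcp hrho.
have h15 := back_finite_invariant_section hX hf_borel hf_acyclic hmcp hrho.
have h43 := invariant_section_return hf_acyclic
  (mu := mu) (E := orbit_rel f).
tfae.
- exact: h12.
- by move=> [Q [mQ Q0 Qoo]]; exact: (summable_return_one_ended hf_borel hf_acyclic hmcp mQ Q0 Qoo).
- by move=> /h31/h15; exact: finite_to_one_forget.
- by move=> /h43/h31/h15.
- by move=> /finite_to_one_forget/h43/h31.
Qed.
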